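(* Let $\Omega\subseteq\mathbb{H}$ be a symmetric slice domain and let $f:\Omega\to\mathbb{H}$ be a regular function. If $f$ does not vanish identically, then the zero set of $f$ consists of isolated points or isolated 2-spheres of the form $x+y\mathbb{S}$ (with $x,y\in\mathbb{R}$ and $y\neq 0$); that is, the zero set of $f$ is a (possibly empty) union of isolated points and isolated 2-spheres of this form.
   Context: $\mathbb{H}$ is the real algebra of quaternions, $\mathbb{S}=\{q\in\mathbb{H}: q^2=-1\}$ is the 2-sphere of imaginary units, and for $I\in\mathbb{S}$, $L_I=\mathbb{R}+I\mathbb{R}\simeq\mathbb{C}$. For $x,y\in\mathbb{R}$, $x+y\mathbb{S}=\{x+yJ: J\in\mathbb{S}\}$ (a 2-sphere if $y\ne 0$, the singleton $\{x\}$ if $y=0$). A domain is a connected open set. For a domain $\Omega\subseteq\mathbb{H}$ put $\Omega_I=\Omega\cap L_I$. A function $f:\Omega\to\mathbb{H}$ on a domain $\Omega\subseteq\mathbb{H}$ is (slice) regular if for every $I\in\mathbb{S}$ the restriction $f_I=f|_{\Omega_I}$ is holomorphic, meaning $f_I\in C^1(\Omega_I)$ and $\frac12\left(\frac{\partial}{\partial x}+I\frac{\partial}{\partial y}\right)f_I(x+Iy)=0$ on $\Omega_I$. A slice domain is a domain $\Omega\subseteq\mathbb{H}$ intersecting the real axis such that $\Omega_I$ is a domain in $L_I$ for all $I\in\mathbb{S}$. A set $C\subseteq\mathbb{H}$ is (axially) symmetric if for all $x+yI\in C$ with $x,y\in\mathbb{R}$, $I\in\mathbb{S}$, the whole set $x+y\mathbb{S}$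 is contained in $C$. A point or 2-sphere contained in the zero set of $f$ is called isolated if it has a neighborhood containing no other zeros of $f$. *)

(* Defs.v *)
From Stdlib Require Import Reals.
From Coquelicot Require Import Coquelicot.

Open Scope R_scope.

(** [(a, b, c, d)] stands for [a + b i + c j + d k]; addition, real scaling,
    topology and norm are those of the product [R * R * R * R]. *)
Definition quat : Type := (R * R * R * R)%type.

Definition quat_base : NormedModule R_AbsRing :=
  prod_NormedModule R_AbsRing
    (prod_NormedModule R_AbsRing
      (prod_NormedModule R_AbsRing R_NormedModule R_NormedModule)
      R_NormedModule)
    R_NormedModule.

Canonical quat_UniformSpace : UniformSpace :=
  UniformSpace.Pack quat (UniformSpace.class quat_base) quat.
Canonical quat_AbelianMonoid : AbelianMonoid :=
  AbelianMonoid.Pack quat (AbelianMonoid.class quat_base) quat.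
Canonical quat_AbelianGroup : AbelianGroup :=
  AbelianGroup.Pack quat (AbelianGroup.class quat_base) quat.
Canonical quat_ModuleSpace : ModuleSpace R_Ring :=
  ModuleSpace.Pack R_Ring quat (ModuleSpace.class R_Ring quat_base) quat.
Canonical quat_NormedModuleAux : NormedModuleAux R_AbsRing :=
  NormedModuleAux.Pack R_AbsRing quat
    (NormedModuleAux.class R_AbsRing quat_base) quat.
Canonical quat_NormedModule : NormedModule R_AbsRing :=
  NormedModule.Pack R_AbsRing quat
    (NormedModule.class R_AbsRing quat_base) quat.

Definition RtoQuat (x : R) : quat := (x, 0, 0, 0).

Definition qmult (p q : quat) : quat :=
  let '(a1, b1, c1, d1) := p in
  let '(a2, b2, c2, d2) := q in
  (a1 * a2 - b1 * b2 - c1 * c2 - d1 * d2,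
   a1 * b2 + b1 * a2 + c1 * d2 - d1 * c2,
   a1 * c2 - b1 * d2 + c1 * a2 + d1 * b2,
   a1 * d2 + b1 * c2 - c1 * b2 + d1 * a2).

Definition imaginary_unit (q : quat) : Prop := qmult q q = RtoQuat (-1).

(** The quaternion [x + y I]. *)
Definition qpoint (I : quat) (x y : R) : quat :=
  plus (RtoQuat x) (qmult (RtoQuat y) I).

(** The set [x + y S]. *)
Definition sphere (x y : R) (q : quat) : Prop :=
  exists J : quat, imaginary_unit J /\ q = qpoint J x y.

Definition connected {T : UniformSpace} (D : T -> Prop) : Prop :=
  forall U V : T -> Prop, open U -> open V ->
    (forall p, D p -> U p \/ V p) ->
    (exists p, D p /\ U p) -> (exists p, D p /\ V p) ->
    exists p, D p /\ U p /\ V p.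

Definition domain {T : UniformSpace} (D : T -> Prop) : Prop :=
  open D /\ connected D.

(** [Omega_I], read in the plane through the homeomorphism
    [(x, y) |-> x + y I] from [R * R] onto [L_I]. *)
Definition slice (Omega : quat -> Prop) (I : quat) (z : R * R) : Prop :=
  Omega (qpoint I (fst z) (snd z)).

Definition slice_domain (Omega : quat -> Prop) : Prop :=
  domain Omega /\
  (exists x : R, Omega (RtoQuat x)) /\
  (forall I : quat, imaginary_unit I -> domain (slice Omega I)).

Definition symmetric (C : quat -> Prop) : Prop :=
  forall (x y : R) (I : quat), imaginary_unit I -> C (qpoint I x y) ->
    forall q : quat, sphere x y q -> C q.

(** [F] is of class C^1 on the open set [D], with partial derivatives [Fx] and
    [Fy], and is annihilated by the Cauchy-Riemann operator of [L_I], where [I]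
    acts by multiplication on the left. *)
Definition holomorphic_on (I : quat) (D : R * R -> Prop) (F : R * R -> quat) : Prop :=
  exists Fx Fy : R * R -> quat,
    forall x y : R, D (x, y) ->
      is_derive (fun t : R => F (t, y)) x (Fx (x, y)) /\
      is_derive (fun t : R => F (x, t)) y (Fy (x, y)) /\
      continuous Fx (x, y) /\
      continuous Fy (x, y) /\
      scal (/ 2) (plus (Fx (x, y)) (qmult I (Fy (x, y)))) = zero.

(** Functions on [Omega] are represented by total functions; only the values
    on [Omega] matter, since each [slice Omega I] is open. *)
Definition regular (Omega : quat -> Prop) (f : quat -> quat) : Prop :=
  forall I : quat, imaginary_unit I ->
    holomorphic_on I (slice Omega I) (fun z => f (qpoint I (fst z) (snd z))).

Definition zero_set (Omega : quat -> Prop) (f : quat -> quat) (q : quat) : Prop :=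
  Omega q /\ f q = zero.

Definition isolated_in (Z A : quat -> Prop) : Prop :=
  (forall q, A q -> Z q) /\
  exists U : quat -> Prop,
    open U /\ (forall q, A q -> U q) /\ (forall q, U q -> Z q -> A q).

Definition is_point (A : quat -> Prop) : Prop :=
  exists p : quat, forall q, A q <-> q = p.

Definition is_two_sphere (A : quat -> Prop) : Prop :=
  exists x y : R, y <> 0 /\ forall q, A q <-> sphere x y q.

(* Main.v *)
From Stdlib Require Import Lra Lia Classical Nsatz.
Require Import Defs.
From Stdlib Require Import Reals.
From Coquelicot Require Import Coquelicot.

(** The values of [f] on all slices are governed by one holomorphic object.
    Put [b(z) = (f(x+yi) + f(x-yi)) / 2] and [c(z) = i (f(x-yi) - f(x+yi)) / 2].
    For each fixed quaternion [v], the complex function [<v, b> + i <v, c>]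
    ([stem f v]) is holomorphic on the base slice [D]. For any imaginary unit
    [J], the function [x + yJ |-> f(x+yJ) - (b + Jc)] is holomorphic on the
    slice of [J] and vanishes on the real axis, hence everywhere: this is the
    identity theorem, and it gives [f(x+yJ) = b(x,y) + J c(x,y)]
    ([representation_formula]).

    On one sphere [x + yS] this expression is affine in [J], so it vanishes at
    every [J], at one [J], or nowhere ([sphere_zero_of_two_zeros]). Distinct
    spheres are separated by the symmetrization: summing the squares of the
    stem functions of an orthonormal basis gives the holomorphic function
    [h = |b|^2 - |c|^2 + 2i <b, c>]. A zero [b = -Jc] of [f] forces [|b| = |c|]
    and makes [b] orthogonal to [c], so [h] vanishes at [(x, y)] whenever [f]
    has a zero on [x + yS]. If [h] were identically zero, then on the real
    axis, where [c = 0], one would get [b = 0]; the stem functions would vanish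
    on the reals, hence on [D], and [f] would be zero. So the zeros of [h] are
    isolated, and the zeros of [f] lie on spheres that do not accumulate in the
    domain ([zeros_near_one_sphere]).

    The complex analysis behind this is the dichotomy [identity_theorem] for
    C^1 solutions of the Cauchy-Riemann equations on a planar domain. It
    follows from Cauchy's formula on a circle ([cauchy_formula]), proved by
    contracting the circle to a point, and from the expansion of the Cauchy
    kernel as a finite geometric sum with remainder: either all Taylor
    coefficients vanish and the remainder estimate forces the function to be
    zero near the centre, or the first nonzero coefficient dominates close to
    it. *)

(** * Calculus along complex curves *)

Definition path_derive (g : R -> C) (t : R) (l : C) : Prop :=
  is_derive (fun s => Re (g s)) t (Re l) /\
  is_derive (fun s => Im (g s)) t (Im l).

Definition Ccontinuous {T : UniformSpace} (g : T -> C) (p : T) : Prop :=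
  continuous (fun s => Re (g s)) p /\ continuous (fun s => Im (g s)) p.

Lemma is_derive_eq (f : R -> R) (t l l' : R) :
  is_derive f t l -> l = l' -> is_derive f t l'.
Proof. now intros H <-. Qed.

Lemma is_derive_times (f g : R -> R) (t a b : R) :
  is_derive f t a -> is_derive g t b ->
  is_derive (fun s => f s * g s) t (a * g t + f t * b).
Proof.
  intros Hf Hg.
  apply (is_derive_mult (K := R_AbsRing) f g t a b Hf Hg).
  intros x y; apply Rmult_comm.
Qed.

Lemma path_derive_eq (g : R -> C) (t : R) (l l' : C) :
  path_derive g t l -> l = l' -> path_derive g t l'.
Proof. now intros H <-. Qed.

Lemma path_derive_ext (g h : R -> C) (t : R) (l : C) :
  (forall s, g s = h s) -> path_derive g t l -> path_derive h t l.
Proof.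
  intros E [H1 H2]; split.
  - apply (is_derive_ext (fun s => Re (g s))); [|exact H1].
    now intros s; rewrite E.
  - apply (is_derive_ext (fun s => Im (g s))); [|exact H2].
    now intros s; rewrite E.
Qed.

Lemma path_derive_const (c : C) (t : R) : path_derive (fun _ => c) t 0%C.
Proof.
  split.
  - exact (is_derive_const (K := R_AbsRing) (V := R_NormedModule) (Re c) t).
  - exact (is_derive_const (K := R_AbsRing) (V := R_NormedModule) (Im c) t).
Qed.

Lemma path_derive_id (t : R) : path_derive (fun s => RtoC s) t 1%C.
Proof.
  split.
  - exact (is_derive_id (K := R_AbsRing) t).
  - exact (is_derive_const (K := R_AbsRing) (V := R_NormedModule) 0 t).
Qed.

Lemma path_derive_plus (g h : R -> C) (t : R) (a b : C) :
  path_derive g t a -> path_derive h t b ->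
  path_derive (fun s => g s + h s)%C t (a + b)%C.
Proof.
  intros [G1 G2] [H1 H2]; split.
  - exact (is_derive_plus (K := R_AbsRing) _ _ _ _ _ G1 H1).
  - exact (is_derive_plus (K := R_AbsRing) _ _ _ _ _ G2 H2).
Qed.

Lemma path_derive_mult (g h : R -> C) (t : R) (a b : C) :
  path_derive g t a -> path_derive h t b ->
  path_derive (fun s => g s * h s)%C t (a * h t + g t * b)%C.
Proof.
  intros [G1 G2] [H1 H2]; split; simpl.
  - eapply is_derive_eq.
    + apply (is_derive_minus (K := R_AbsRing)
               (fun s => Re (g s) * Re (h s)) (fun s => Im (g s) * Im (h s)));
        apply is_derive_times; eassumption.
    + unfold minus, plus, opp, Re, Im; simpl; ring.
  - eapply is_derive_eq.
    + apply (is_derive_plus (K := R_AbsRing)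
               (fun s => Re (g s) * Im (h s)) (fun s => Im (g s) * Re (h s)));
        apply is_derive_times; eassumption.
    + unfold plus, Re, Im; simpl; ring.
Qed.

Lemma path_derive_conj (g : R -> C) (t : R) (a : C) :
  path_derive g t a -> path_derive (fun s => Cconj (g s)) t (Cconj a).
Proof.
  intros [G1 G2]; split; simpl.
  - exact G1.
  - exact (is_derive_opp (K := R_AbsRing) _ _ _ G2).
Qed.

Lemma path_derive_continuous (g : R -> C) (t : R) (a : C) :
  path_derive g t a -> Ccontinuous g t.
Proof.
  intros [G1 G2]; split;
    apply (ex_derive_continuous (K := R_AbsRing) (V := R_NormedModule)); eexists; eassumption.
Qed.

Section CcontinuousRules.
Context {T : UniformSpace}.
Implicit Types (g h : T -> C) (p : T).

Lemma Ccontinuous_ext g h p :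
  (forall s, g s = h s) -> Ccontinuous g p -> Ccontinuous h p.
Proof.
  intros E [H1 H2]; split.
  - apply (continuous_ext (fun s => Re (g s))); [|exact H1].
    now intros s; rewrite E.
  - apply (continuous_ext (fun s => Im (g s))); [|exact H2].
    now intros s; rewrite E.
Qed.

Lemma Ccontinuous_const (c : C) p : Ccontinuous (fun _ : T => c) p.
Proof. split; apply continuous_const. Qed.

Lemma Ccontinuous_plus g h p :
  Ccontinuous g p -> Ccontinuous h p -> Ccontinuous (fun s => g s + h s)%C p.
Proof.
  intros [G1 G2] [H1 H2]; split.
  - exact (continuous_plus (K := R_AbsRing) (V := R_NormedModule) _ _ _ G1 H1).
  - exact (continuous_plus (K := R_AbsRing) (V := R_NormedModule) _ _ _ G2 H2).
Qed.

Lemma Ccontinuous_mult g h p :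
  Ccontinuous g p -> Ccontinuous h p -> Ccontinuous (fun s => g s * h s)%C p.
Proof.
  intros [G1 G2] [H1 H2]; split.
  - apply (continuous_minus (K := R_AbsRing) (V := R_NormedModule)
             (fun s => Re (g s) * Re (h s)) (fun s => Im (g s) * Im (h s)));
      now apply (continuous_mult (K := R_AbsRing)).
  - apply (continuous_plus (K := R_AbsRing) (V := R_NormedModule)
             (fun s => Re (g s) * Im (h s)) (fun s => Im (g s) * Re (h s)));
      now apply (continuous_mult (K := R_AbsRing)).
Qed.

Lemma Ccontinuous_conj g p :
  Ccontinuous g p -> Ccontinuous (fun s => Cconj (g s)) p.
Proof.
  intros [G1 G2]; split; simpl; [exact G1|].
  exact (continuous_opp (K := R_AbsRing) (V := R_NormedModule) _ _ G2).
Qed.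

Lemma Ccontinuous_inv g p :
  g p <> 0%C -> Ccontinuous g p -> Ccontinuous (fun s => / g s)%C p.
Proof.
  intros Hp [G1 G2].
  assert (Hn : Re (g p) ^ 2 + Im (g p) ^ 2 <> 0).
  { intros E; apply Hp; apply injective_projections; simpl;
      unfold Re, Im in E; nra. }
  assert (Hc : continuous (fun s => / (Re (g s) ^ 2 + Im (g s) ^ 2)) p).
  { apply (continuous_comp (fun s => Re (g s) ^ 2 + Im (g s) ^ 2) Rinv).
    - apply (continuous_plus (K := R_AbsRing) (V := R_NormedModule)
               (fun s => Re (g s) ^ 2) (fun s => Im (g s) ^ 2)); simpl;
        repeat apply (continuous_mult (K := R_AbsRing)); try assumption;
        apply continuous_const.
    - apply continuous_Rinv; exact Hn. }
  split.
  - exact (continuous_mult (K := R_AbsRing) _ _ _ G1 Hc).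
  - apply (continuous_mult (K := R_AbsRing) (fun s => - Im (g s))); [|exact Hc].
    exact (continuous_opp (K := R_AbsRing) (V := R_NormedModule) _ _ G2).
Qed.

Lemma Ccontinuous_comp (g : T -> C) (F : C -> C) p :
  Ccontinuous g p -> Ccontinuous (F : prod_UniformSpace _ _ -> C) (g p) ->
  Ccontinuous (fun s => F (g s)) p.
Proof.
  intros [G1 G2] [F1 F2]; split.
  - apply (continuous_ext (fun s => (fun a b => Re (F (a, b))) (Re (g s)) (Im (g s)))).
    { now intros s; unfold Re, Im; rewrite <- surjective_pairing. }
    apply (continuous_comp_2 _ _ (fun a b => Re (F (a, b))) p G1 G2).
    unfold Re, Im; rewrite <- surjective_pairing.
    eapply continuous_ext; [|exact F1].
    now intros s; simpl; rewrite <- surjective_pairing.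
  - apply (continuous_ext (fun s => (fun a b => Im (F (a, b))) (Re (g s)) (Im (g s)))).
    { now intros s; unfold Re, Im; rewrite <- surjective_pairing. }
    apply (continuous_comp_2 _ _ (fun a b => Im (F (a, b))) p G1 G2).
    unfold Re, Im; rewrite <- surjective_pairing.
    eapply continuous_ext; [|exact F2].
    now intros s; simpl; rewrite <- surjective_pairing.
Qed.

End CcontinuousRules.

(** * Holomorphic functions *)

(** Complex differentiability is expressed through the chain rule along curves:
    in this form the algebraic rules, conjugation on both sides and affine
    substitution follow from the calculus of curves alone, and it is also the
    form in which Cauchy's formula consumes it. *)
Definition holomorphic (D : C -> Prop) (F F' : C -> C) : Prop :=
  forall z, D z ->
    (forall g t l, g t = z -> path_derive g t l ->
       path_derive (fun s => F (g s)) t (F' z * l)%C) /\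
    Ccontinuous F z /\ Ccontinuous F' z.

Section HolomorphicRules.
Variable D : C -> Prop.

Lemma holomorphic_ext (F G F' : C -> C) :
  (forall z, F z = G z) -> holomorphic D F F' -> holomorphic D G F'.
Proof.
  intros E H z Dz; destruct (H z Dz) as [H1 [H2 H3]]; split; [|split].
  - intros g t l Hg Hl; apply (path_derive_ext (fun s => F (g s))).
    + now intros s; apply E.
    + exact (H1 g t l Hg Hl).
  - exact (Ccontinuous_ext _ _ _ E H2).
  - exact H3.
Qed.

Lemma holomorphic_const (c : C) : holomorphic D (fun _ => c) (fun _ => 0%C).
Proof.
  intros z _; split; [|split]; try apply Ccontinuous_const.
  intros; eapply path_derive_eq; [apply path_derive_const|ring].
Qed.

Lemma holomorphic_plus (F G F' G' : C -> C) :
  holomorphic D F F' -> holomorphic D G G' ->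
  holomorphic D (fun z => F z + G z)%C (fun z => F' z + G' z)%C.
Proof.
  intros HF HG z Dz.
  destruct (HF z Dz) as [F1 [F2 F3]], (HG z Dz) as [G1 [G2 G3]].
  split; [|split]; try now apply Ccontinuous_plus.
  intros g t l Hg Hl; eapply path_derive_eq.
  - apply path_derive_plus; [exact (F1 g t l Hg Hl)|exact (G1 g t l Hg Hl)].
  - ring.
Qed.

Lemma holomorphic_mult (F G F' G' : C -> C) :
  holomorphic D F F' -> holomorphic D G G' ->
  holomorphic D (fun z => F z * G z)%C (fun z => F' z * G z + F z * G' z)%C.
Proof.
  intros HF HG z Dz.
  destruct (HF z Dz) as [F1 [F2 F3]], (HG z Dz) as [G1 [G2 G3]].
  split; [|split].
  - intros g t l Hg Hl; eapply path_derive_eq.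
    + apply path_derive_mult; [exact (F1 g t l Hg Hl)|exact (G1 g t l Hg Hl)].
    + cbv beta; rewrite Hg; ring.
  - now apply Ccontinuous_mult.
  - apply Ccontinuous_plus; now apply Ccontinuous_mult.
Qed.

Lemma holomorphic_conj (F F' : C -> C) :
  (forall z, D z -> D (Cconj z)) -> holomorphic D F F' ->
  holomorphic D (fun z => Cconj (F (Cconj z))) (fun z => Cconj (F' (Cconj z))).
Proof.
  intros HD HF z Dz.
  destruct (HF _ (HD z Dz)) as [F1 [F2 F3]].
  assert (Hid : Ccontinuous (fun z : C => Cconj z) z).
  { apply Ccontinuous_conj; split; [apply continuous_fst|apply continuous_snd]. }
  split; [|split].
  - intros g t l Hg Hl.
    eapply path_derive_eq.
    + apply path_derive_conj, (F1 (fun s => Cconj (g s)) t).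
      * now rewrite Hg.
      * exact (path_derive_conj g t l Hl).
    + now rewrite Cmult_conj, Cconj_conj.
  - apply Ccontinuous_conj.
    exact (Ccontinuous_comp (fun z => Cconj z) F z Hid F2).
  - apply Ccontinuous_conj.
    exact (Ccontinuous_comp (fun z => Cconj z) F' z Hid F3).
Qed.

Lemma holomorphic_affine (E : C -> Prop) (a b : C) (F F' : C -> C) :
  (forall z, E z -> D (a + b * z)%C) -> holomorphic D F F' ->
  holomorphic E (fun z => F (a + b * z))%C (fun z => F' (a + b * z) * b)%C.
Proof.
  intros HD HF z Dz.
  destruct (HF _ (HD z Dz)) as [F1 [F2 F3]].
  assert (Hid : Ccontinuous (fun z : C => a + b * z)%C z).
  { apply Ccontinuous_plus; [apply Ccontinuous_const|].
    apply Ccontinuous_mult; [apply Ccontinuous_const|].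
    split; [apply continuous_fst|apply continuous_snd]. }
  split; [|split].
  - intros g t l Hg Hl.
    eapply path_derive_eq.
    + apply (F1 (fun s => a + b * g s)%C t).
      * now rewrite Hg.
      * apply path_derive_plus; [apply path_derive_const|].
        apply path_derive_mult; [apply path_derive_const|exact Hl].
    + cbv beta; ring.
  - exact (Ccontinuous_comp (fun z => a + b * z)%C F z Hid F2).
  - apply Ccontinuous_mult; [|apply Ccontinuous_const].
    exact (Ccontinuous_comp (fun z => a + b * z)%C F' z Hid F3).
Qed.

End HolomorphicRules.

(** Continuity of one partial derivative near the point is enough: it
    controls the increment in the first variable uniformly in the second. *)
Lemma differentiable_of_C1 (D : R * R -> Prop) (u ux uy : R * R -> R) :
  open D ->
  (forall x y, D (x, y) ->
     is_derive (fun t => u (t, y)) x (ux (x, y)) /\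
     is_derive (fun t => u (x, t)) y (uy (x, y)) /\
     continuous ux (x, y)) ->
  forall x y, D (x, y) ->
    differentiable_pt_lim (fun a b => u (a, b)) x y (ux (x, y)) (uy (x, y)).
Proof.
  intros HD H x y Dxy.
  apply filterdiff_differentiable_pt_lim.
  eapply filterdiff_ext_lin.
  - apply (is_derive_filterdiff (fun a b => u (a, b)) x y
             (fun a b => ux (a, b)) (uy (x, y))).
    + apply (filter_imp D); [|exact (HD _ Dxy)].
      intros [a b] Dab; apply (H a b Dab).
    + apply (H x y Dxy).
    + apply (continuous_ext ux); [now intros [a b]|apply (H x y Dxy)].
  - intros [a b]; reflexivity.
Qed.

(** By the chain rule in the plane, the derivative of [(u, v)] along a curve is
    the Jacobian applied to its velocity; the Cauchy-Riemann equations say that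
    this Jacobian is multiplication by the complex number [ux + i vx]. *)
Lemma cauchy_riemann_holomorphic (D : R * R -> Prop) (u v ux uy vx vy : R * R -> R) :
  open D ->
  (forall x y, D (x, y) ->
     is_derive (fun t => u (t, y)) x (ux (x, y)) /\
     is_derive (fun t => u (x, t)) y (uy (x, y)) /\
     continuous ux (x, y)) ->
  (forall x y, D (x, y) ->
     is_derive (fun t => v (t, y)) x (vx (x, y)) /\
     is_derive (fun t => v (x, t)) y (vy (x, y)) /\
     continuous vx (x, y)) ->
  (forall z, D z -> uy z = - vx z /\ vy z = ux z) ->
  holomorphic D (fun z => (u z, v z)) (fun z => (ux z, vx z)).
Proof.
  intros HD Hu Hv CR [x y] Dz.
  pose proof (differentiable_of_C1 D u ux uy HD Hu x y Dz) as Du.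
  pose proof (differentiable_of_C1 D v vx vy HD Hv x y Dz) as Dv.
  destruct (CR _ Dz) as [E1 E2]; rewrite E1 in Du; rewrite E2 in Dv.
  split; [|split].
  - intros g t l Hg [L1 L2].
    replace x with (Re (g t)) in Du, Dv by now rewrite Hg.
    replace y with (Im (g t)) in Du, Dv by now rewrite Hg.
    replace (Re (g t), Im (g t)) with (x, y) in Du, Dv by now rewrite Hg.
    split.
    + apply (is_derive_ext (fun s => u (Re (g s), Im (g s)))).
      { now intros s; unfold Re, Im; rewrite <- surjective_pairing. }
      eapply is_derive_eq.
      * apply is_derive_Reals.
        apply (derivable_pt_lim_comp_2d (fun a b => u (a, b))
                 (fun s => Re (g s)) (fun s => Im (g s)) t _ _ (Re l) (Im l) Du);
          apply is_derive_Reals; eassumption.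
      * simpl; unfold Re, Im; ring.
    + apply (is_derive_ext (fun s => v (Re (g s), Im (g s)))).
      { now intros s; unfold Re, Im; rewrite <- surjective_pairing. }
      eapply is_derive_eq.
      * apply is_derive_Reals.
        apply (derivable_pt_lim_comp_2d (fun a b => v (a, b))
                 (fun s => Re (g s)) (fun s => Im (g s)) t _ _ (Re l) (Im l) Dv);
          apply is_derive_Reals; eassumption.
      * simpl; unfold Re, Im; ring.
  - assert (Hc : forall (w : R * R -> R) lx ly,
        differentiable_pt_lim (fun a b => w (a, b)) x y lx ly ->
        continuous w (x, y)).
    { intros w lx ly Hw.
      apply (continuous_ext (fun z => w (fst z, snd z))).
      - now intros z; rewrite <- surjective_pairing.
      - apply (proj1 (continuity_2d_pt_filterlim (fun a b => w (a, b)) x y)).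
        apply differentiable_continuity_pt; now exists lx, ly. }
    split; [exact (Hc u _ _ Du)|exact (Hc v _ _ Dv)].
  - split; [exact (proj2 (proj2 (Hu x y Dz)))|exact (proj2 (proj2 (Hv x y Dz)))].
Qed.

(** * Integrals over the unit circle *)

Definition circle (a : R) : C := (cos a, sin a).

(** The integral over the angle: the factor [dz / (i z)] of a contour integral
    is absorbed. *)
Definition circle_int (g : R -> C) : C :=
  (RInt (fun a => Re (g a)) 0 (2 * PI), RInt (fun a => Im (g a)) 0 (2 * PI)).

Lemma Cmod_circle (a : R) : Cmod (circle a) = 1.
Proof.
  unfold Cmod, circle; simpl.
  replace (cos a * (cos a * 1) + sin a * (sin a * 1)) with (Rsqr (sin a) + Rsqr (cos a))
    by (unfold Rsqr; ring).
  rewrite sin2_cos2; apply sqrt_1.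
Qed.

Lemma circle_neq_0 (a : R) : circle a <> 0%C.
Proof.
  intros E; pose proof (Cmod_circle a) as H; rewrite E, Cmod_0 in H; lra.
Qed.

Lemma circle_minus_neq_0 (w : C) (a : R) : Cmod w < 1 -> (circle a - w)%C <> 0%C.
Proof.
  intros Hw E; pose proof (Cmod_circle a) as H.
  replace (circle a) with w in H; [lra|].
  transitivity (w + (circle a - w))%C; [rewrite E; ring|ring].
Qed.

Lemma circle_derive (a : R) : path_derive circle a (Ci * circle a)%C.
Proof.
  split; simpl.
  - eapply is_derive_eq; [apply is_derive_cos|unfold Re; simpl; ring].
  - eapply is_derive_eq; [apply is_derive_sin|unfold Im; simpl; ring].
Qed.

Lemma circle_continuous (a : R) : Ccontinuous circle a.
Proof. exact (path_derive_continuous _ _ _ (circle_derive a)). Qed.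

Lemma ex_RInt_of_continuous (f : R -> R) (a b : R) :
  (forall x, continuous f x) -> ex_RInt f a b.
Proof.
  intros H; apply (ex_RInt_continuous (V := R_CompleteNormedModule)).
  intros z _; apply H.
Qed.

Lemma circle_int_ext (g h : R -> C) :
  (forall a, g a = h a) -> circle_int g = circle_int h.
Proof.
  intros E; unfold circle_int; f_equal;
    apply RInt_ext; intros a _; now rewrite E.
Qed.

Lemma circle_int_plus (g h : R -> C) :
  (forall a, Ccontinuous g a) -> (forall a, Ccontinuous h a) ->
  circle_int (fun a => g a + h a)%C = (circle_int g + circle_int h)%C.
Proof.
  intros Hg Hh; apply injective_projections; simpl.
  - apply (RInt_plus (V := R_CompleteNormedModule));
      apply ex_RInt_of_continuous; [apply Hg|apply Hh].
  - apply (RInt_plus (V := R_CompleteNormedModule));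
      apply ex_RInt_of_continuous; [apply Hg|apply Hh].
Qed.

Lemma circle_int_scal (c : C) (g : R -> C) :
  (forall a, Ccontinuous g a) ->
  circle_int (fun a => c * g a)%C = (c * circle_int g)%C.
Proof.
  intros Hg.
  assert (H1 : ex_RInt (fun a => Re (g a)) 0 (2 * PI))
    by (apply ex_RInt_of_continuous; apply Hg).
  assert (H2 : ex_RInt (fun a => Im (g a)) 0 (2 * PI))
    by (apply ex_RInt_of_continuous; apply Hg).
  assert (S : forall k f, ex_RInt f 0 (2 * PI) ->
    is_RInt (fun a => k * f a) 0 (2 * PI) (k * RInt f 0 (2 * PI))).
  { intros k f Hf; apply (is_RInt_scal (V := R_NormedModule)).
    now apply (RInt_correct (V := R_CompleteNormedModule)). }
  apply injective_projections; simpl; apply is_RInt_unique.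
  - apply (is_RInt_minus (V := R_NormedModule)
             (fun a => fst c * Re (g a)) (fun a => snd c * Im (g a)));
      now apply S.
  - apply (is_RInt_plus (V := R_NormedModule)
             (fun a => fst c * Im (g a)) (fun a => snd c * Re (g a)));
      now apply S.
Qed.

Lemma Cmod_le_Rabs (z : C) : Cmod z <= Rabs (Re z) + Rabs (Im z).
Proof.
  replace z with (RtoC (Re z) + Ci * RtoC (Im z))%C at 1
    by (apply injective_projections; simpl; unfold Re, Im; ring).
  eapply Rle_trans; [apply Cmod_triangle|].
  rewrite Cmod_mult, !Cmod_R.
  replace (Cmod Ci) with 1; [lra|].
  rewrite <- sqrt_1 at 1; unfold Cmod, Ci; simpl; f_equal; ring.
Qed.

Lemma im_le_Cmod (z : C) : Rabs (Im z) <= Cmod z.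
Proof. eapply Rle_trans; [apply Rmax_r|apply Rmax_Cmod]. Qed.

Lemma circle_int_bound (g : R -> C) (M : R) :
  (forall a, Ccontinuous g a) -> (forall a, 0 <= a <= 2 * PI -> Cmod (g a) <= M) ->
  Cmod (circle_int g) <= 4 * PI * M.
Proof.
  intros Hg HM; pose proof PI_RGT_0.
  eapply Rle_trans; [apply Cmod_le_Rabs|]; unfold circle_int; simpl.
  assert (H1 : Rabs (RInt (fun a => Re (g a)) 0 (2 * PI)) <= (2 * PI - 0) * M).
  { apply abs_RInt_le_const; [lra|apply ex_RInt_of_continuous; apply Hg|].
    intros a Ha; eapply Rle_trans; [apply re_le_Cmod|now apply HM]. }
  assert (H2 : Rabs (RInt (fun a => Im (g a)) 0 (2 * PI)) <= (2 * PI - 0) * M).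
  { apply abs_RInt_le_const; [lra|apply ex_RInt_of_continuous; apply Hg|].
    intros a Ha; eapply Rle_trans; [apply im_le_Cmod|now apply HM]. }
  lra.
Qed.

(** * Cauchy's formula *)

(** Differentiating under the integral sign, [t] times the derivative of the
    integral of [P t] is the integral of a derivative in the angle, which is
    zero by periodicity; so for [t > 0] the integral is stationary. The
    factor [t] gives nothing at [t = 0], where only continuity is needed for the
    mean value theorem. *)
Lemma RInt_homotopy (P P' Q : R -> R -> R) (b : R) :
  (forall t a, -1/2 < t < 3/2 -> is_derive (fun s => P s a) t (P' t a)) ->
  (forall t a, -1/2 < t < 3/2 ->
     continuous (fun z : R * R => P' (fst z) (snd z)) (t, a)) ->
  (forall t a, -1/2 < t < 3/2 -> continuous (P t) a) ->
  (forall t a, -1/2 < t < 3/2 -> is_derive (Q t) a (t * P' t a)) ->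
  (forall t, Q t 0 = Q t b) ->
  RInt (P 1) 0 b = RInt (P 0) 0 b.
Proof.
  intros HP HP' HPc HQ Hper.
  assert (Hloc : forall t, -1/2 < t < 3/2 -> locally t (fun s => -1/2 < s < 3/2)).
  { intros t [Ht1 Ht2].
    exact (filter_and _ _ (open_gt (-1/2) t Ht1) (open_lt (3/2) t Ht2)). }
  assert (Hder : forall t, -1/2 < t < 3/2 ->
    is_derive (fun s => RInt (P s) 0 b) t (RInt (fun a => P' t a) 0 b)).
  { intros t Ht.
    replace (RInt (fun a => P' t a) 0 b)
      with (RInt (fun a => Derive (fun s => P s a) t) 0 b)
      by (apply RInt_ext; intros a _; apply is_derive_unique, HP, Ht).
    apply is_derive_RInt_param.
    - apply (filter_imp (fun s => -1/2 < s < 3/2)); [|exact (Hloc t Ht)].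
      intros s Hs a _; eexists; exact (HP s a Hs).
    - intros a _.
      apply (continuity_2d_pt_ext_loc P').
      + apply locally_2d_locally.
        destruct (Hloc t Ht) as [eps Heps].
        exists eps; intros [s c] [Hs _]; simpl.
        symmetry; apply is_derive_unique, HP, Heps, Hs.
      + apply continuity_2d_pt_filterlim; exact (HP' t a Ht).
    - apply (filter_imp (fun s => -1/2 < s < 3/2)); [|exact (Hloc t Ht)].
      intros s Hs; apply ex_RInt_of_continuous; intros a; exact (HPc s a Hs). }
  assert (Hzero : forall t, 0 < t < 3/2 -> RInt (fun a => P' t a) 0 b = 0).
  { intros t Ht.
    assert (Ht' : -1/2 < t < 3/2) by lra.
    assert (Hc : forall a, continuous (fun a => P' t a) a).
    { intros a.
      apply (continuous_comp_2 (fun _ : R => t) (fun c : R => c) P' a).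
      - apply continuous_const.
      - apply continuous_id.
      - exact (HP' t a Ht'). }
    assert (H1 : is_RInt (fun a => t * P' t a) 0 b (minus (Q t b) (Q t 0))).
    { apply (is_RInt_derive (V := R_CompleteNormedModule) (Q t)).
      - intros a _; exact (HQ t a Ht').
      - intros a _.
        apply (continuous_mult (K := R_AbsRing) (fun _ => t)).
        + apply continuous_const.
        + apply Hc. }
    assert (H2 : is_RInt (fun a => t * P' t a) 0 b (t * RInt (fun a => P' t a) 0 b)).
    { apply (is_RInt_scal (V := R_NormedModule)).
      apply (RInt_correct (V := R_CompleteNormedModule)).
      now apply ex_RInt_of_continuous. }
    rewrite Hper in H1.
    apply (is_RInt_unique (V := R_CompleteNormedModule)) in H1, H2.
    rewrite H2 in H1; unfold minus, plus, opp in H1; simpl in H1.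
    apply Rmult_eq_reg_l with t; lra. }
  destruct (MVT_gen (fun s => RInt (P s) 0 b) 0 1 (fun _ => 0)) as [c [_ Hc]].
  - rewrite Rmin_left, Rmax_right by lra; intros t Ht.
    eapply is_derive_eq; [apply Hder; lra|apply Hzero; lra].
  - rewrite Rmin_left, Rmax_right by lra; intros t Ht.
    apply continuity_pt_filterlim.
    apply (ex_derive_continuous (K := R_AbsRing) (V := R_NormedModule)
             (fun s => RInt (P s) 0 b) t).
    eexists; apply Hder; lra.
  - lra.
Qed.

Lemma circle_int_homotopy (P P' Q : R -> R -> C) :
  (forall t a, -1/2 < t < 3/2 -> path_derive (fun s => P s a) t (P' t a)) ->
  (forall t a, -1/2 < t < 3/2 ->
     Ccontinuous (fun z : R * R => P' (fst z) (snd z)) (t, a)) ->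
  (forall t a, -1/2 < t < 3/2 -> Ccontinuous (P t) a) ->
  (forall t a, -1/2 < t < 3/2 -> path_derive (Q t) a (RtoC t * P' t a)%C) ->
  (forall t, Q t 0 = Q t (2 * PI)) ->
  circle_int (P 1) = circle_int (P 0).
Proof.
  intros HP HP' HPc HQ Hper; unfold circle_int; f_equal.
  - apply (RInt_homotopy (fun t a => Re (P t a)) (fun t a => Re (P' t a))
             (fun t a => Re (Q t a))).
    + intros t a Ht; apply (HP t a Ht).
    + intros t a Ht; apply (HP' t a Ht).
    + intros t a Ht; apply (HPc t a Ht).
    + intros t a Ht; eapply is_derive_eq; [apply (HQ t a Ht)|].
      simpl; unfold Re; ring.
    + intros t; now rewrite Hper.
  - apply (RInt_homotopy (fun t a => Im (P t a)) (fun t a => Im (P' t a))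
             (fun t a => Im (Q t a))).
    + intros t a Ht; apply (HP t a Ht).
    + intros t a Ht; apply (HP' t a Ht).
    + intros t a Ht; apply (HPc t a Ht).
    + intros t a Ht; eapply is_derive_eq; [apply (HQ t a Ht)|].
      simpl; unfold Im; ring.
    + intros t; now rewrite Hper.
Qed.

Lemma kernel_continuous (w : C) (a : R) :
  Cmod w < 1 -> Ccontinuous (fun a => circle a / (circle a - w))%C a.
Proof.
  intros Hw; apply Ccontinuous_mult; [apply circle_continuous|].
  apply Ccontinuous_inv; [now apply circle_minus_neq_0|].
  apply Ccontinuous_plus; [apply circle_continuous|apply Ccontinuous_const].
Qed.

(** The circle is contracted to [w] along the segments
    [ray t a = w + t (e^(ia) - w)]. The derivative in [t] of
    [F (ray t a) * e^(ia) / (e^(ia) - w)] is [F' (ray t a) * e^(ia)], and [t]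
    times this is the derivative in [a] of [-i F (ray t a)], a periodic
    function. *)
Lemma cauchy_formula (F F' : C -> C) (w : C) :
  holomorphic (fun z => Cmod z < 2) F F' -> Cmod w < 1 ->
  circle_int (fun a => F (circle a) * (circle a / (circle a - w)))%C =
  (F w * circle_int (fun a => circle a / (circle a - w)))%C.
Proof.
  intros HF Hw.
  set (ray := fun t a => (w + RtoC t * (circle a - w))%C).
  assert (Hray : forall t a, -1/2 < t < 3/2 -> Cmod (ray t a) < 2).
  { (* As [|w| < 1], [|ray t a| <= |1-t| |w| + |t|], which stays below 2 for
       [t] between -1/2 and 3/2. *)
    intros t a Ht; unfold ray.
    replace (w + RtoC t * (circle a - w))%C with (RtoC (1 - t) * w + RtoC t * circle a)%C
      by (rewrite RtoC_minus; ring).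
    eapply Rle_lt_trans; [apply Cmod_triangle|].
    rewrite !Cmod_mult, !Cmod_R, Cmod_circle.
    pose proof (Cmod_ge_0 w).
    destruct (Rle_dec t 1) as [H1|H1].
    - rewrite (Rabs_right (1 - t)) by lra.
      unfold Rabs; destruct (Rcase_abs t); nra.
    - rewrite (Rabs_left (1 - t)), (Rabs_right t) by lra; nra. }
  assert (Hdray1 : forall t a, path_derive (fun s => ray s a) t (circle a - w)%C).
  { intros t a; unfold ray; eapply path_derive_eq.
    - apply path_derive_plus; [apply path_derive_const|].
      apply path_derive_mult; [apply path_derive_id|apply path_derive_const].
    - cbv beta; ring. }
  assert (Hdray2 : forall t a, path_derive (ray t) a (RtoC t * (Ci * circle a))%C).
  { intros t a; unfold ray; eapply path_derive_eq.
    - apply path_derive_plus; [apply path_derive_const|].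
      apply path_derive_mult; [apply path_derive_const|].
      apply path_derive_plus; [apply circle_derive|apply path_derive_const].
    - cbv beta; ring. }
  transitivity (circle_int (fun a => F (ray 1 a) * (circle a / (circle a - w)))%C).
  { apply circle_int_ext; intros a; do 2 f_equal; unfold ray; ring. }
  transitivity (circle_int (fun a => F (ray 0 a) * (circle a / (circle a - w)))%C).
  2: { rewrite <- circle_int_scal by (intros a; now apply kernel_continuous).
       apply circle_int_ext; intros a; do 2 f_equal; unfold ray; ring. }
  apply (circle_int_homotopy
           (fun t a => F (ray t a) * (circle a / (circle a - w)))%C
           (fun t a => F' (ray t a) * circle a)%C
           (fun t a => - Ci * F (ray t a))%C).
  - intros t a Ht; destruct (HF _ (Hray t a Ht)) as [F1 _].
    eapply path_derive_eq.
    + apply path_derive_mult; [|apply path_derive_const].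
      exact (F1 (fun s => ray s a) t _ eq_refl (Hdray1 t a)).
    + cbv beta; field; now apply circle_minus_neq_0.
  - intros t a Ht; destruct (HF _ (Hray t a Ht)) as [_ [_ F3]].
    assert (Hc : Ccontinuous (fun z : R * R => circle (snd z)) (t, a)).
    { destruct (circle_continuous a) as [C1 C2]; split.
      - apply (continuous_comp (fun z : R * R => snd z) (fun b => Re (circle b)));
          [apply continuous_snd|exact C1].
      - apply (continuous_comp (fun z : R * R => snd z) (fun b => Im (circle b)));
          [apply continuous_snd|exact C2]. }
    apply Ccontinuous_mult; [|exact Hc].
    apply (Ccontinuous_comp (fun z : R * R => ray (fst z) (snd z)) F' (t, a));
      [|exact F3].
    apply Ccontinuous_plus; [apply Ccontinuous_const|].
    apply Ccontinuous_mult.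
    + split; [apply continuous_fst|apply continuous_const].
    + apply Ccontinuous_plus; [exact Hc|apply Ccontinuous_const].
  - intros t a Ht; destruct (HF _ (Hray t a Ht)) as [F1 _].
    apply Ccontinuous_mult; [|now apply kernel_continuous].
    exact (path_derive_continuous _ _ _ (F1 (ray t) a _ eq_refl (Hdray2 t a))).
  - intros t a Ht; destruct (HF _ (Hray t a Ht)) as [F1 _].
    eapply path_derive_eq.
    + apply path_derive_mult; [apply path_derive_const|].
      exact (F1 (ray t) a _ eq_refl (Hdray2 t a)).
    + cbv beta.
      transitivity (- (Ci * Ci) * (RtoC t * (F' (ray t a) * circle a)))%C; [ring|].
      replace (Ci * Ci)%C with (- (1))%C; [ring|].
      apply injective_projections; simpl; ring.
  - intros t; unfold ray, circle.
    now rewrite cos_0, sin_0, cos_2PI, sin_2PI.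
Qed.

(** * Zeros of holomorphic functions *)

(** [coeff g n] is, up to the factor [2 pi], the [n]-th Taylor coefficient at 0
    of the function with boundary values [g] on the unit circle; [remainder g n w]
    is the Cauchy integral at [w], with the same factor, of [g / z^n]. *)
Definition coeff (g : R -> C) (n : nat) : C :=
  circle_int (fun a => g a * (/ circle a) ^ n)%C.

Definition remainder (g : R -> C) (n : nat) (w : C) : C :=
  circle_int (fun a => g a * (/ circle a) ^ n * (circle a / (circle a - w)))%C.

Lemma circle_inv_pow_continuous (n : nat) (a : R) :
  Ccontinuous (fun a => (/ circle a) ^ n)%C a.
Proof.
  induction n as [|n IH]; simpl; [apply Ccontinuous_const|].
  apply Ccontinuous_mult; [|exact IH].
  apply Ccontinuous_inv; [apply circle_neq_0|apply circle_continuous].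
Qed.

(** One term of the geometric series: [z / (z - w) = 1 + (w / z) (z / (z - w))]. *)
Lemma remainder_step (g : R -> C) (n : nat) (w : C) :
  (forall a, Ccontinuous g a) -> Cmod w < 1 ->
  remainder g n w = (coeff g n + w * remainder g (S n) w)%C.
Proof.
  intros Hg Hw; unfold remainder, coeff.
  assert (Hp : forall n a, Ccontinuous (fun a => g a * (/ circle a) ^ n)%C a).
  { intros m a; apply Ccontinuous_mult; [apply Hg|apply circle_inv_pow_continuous]. }
  assert (Hk : forall n a, Ccontinuous
    (fun a => g a * (/ circle a) ^ n * (circle a / (circle a - w)))%C a).
  { intros m a; apply Ccontinuous_mult; [apply Hp|now apply kernel_continuous]. }
  rewrite <- circle_int_scal by (intros a; apply Hk).
  rewrite <- circle_int_plus; [|intros a; apply Hp|].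
  - apply circle_int_ext; intros a; simpl.
    pose proof (circle_neq_0 a) as Ha.
    pose proof (circle_minus_neq_0 w a Hw) as Haw.
    generalize ((/ circle a) ^ n)%C; intros c; field; now split.
  - intros a; apply Ccontinuous_mult; [apply Ccontinuous_const|apply Hk].
Qed.

Lemma remainder_pow (g : R -> C) (n : nat) (w : C) :
  (forall a, Ccontinuous g a) -> Cmod w < 1 ->
  (forall k, (k < n)%nat -> coeff g k = 0%C) ->
  remainder g 0 w = (w ^ n * remainder g n w)%C.
Proof.
  intros Hg Hw; induction n as [|n IH]; intros H; simpl.
  - now rewrite Cmult_1_l.
  - rewrite IH by (intros k Hk; apply H; lia).
    rewrite (remainder_step g n w Hg Hw), (H n) by lia; ring.
Qed.

Lemma remainder_bound (g : R -> C) (M : R) (n : nat) (w : C) :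
  (forall a, Ccontinuous g a) ->
  (forall a, 0 <= a <= 2 * PI -> Cmod (g a) <= M) ->
  Cmod w <= 1/2 -> Cmod (remainder g n w) <= 4 * PI * (2 * M).
Proof.
  intros Hg HM Hw; apply circle_int_bound.
  - intros a; apply Ccontinuous_mult; [|apply kernel_continuous; lra].
    apply Ccontinuous_mult; [apply Hg|apply circle_inv_pow_continuous].
  - intros a Ha.
    assert (Hne : (circle a - w)%C <> 0%C) by (apply circle_minus_neq_0; lra).
    unfold Cdiv.
    rewrite !Cmod_mult, Cmod_pow, !Cmod_inv by (assumption || apply circle_neq_0).
    rewrite Cmod_circle, Rinv_1, pow1, Rmult_1_r, Rmult_1_l.
    assert (Hd : 1/2 <= Cmod (circle a - w)).
    { pose proof (Cmod_triangle (circle a - w) w) as H.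
      replace (circle a - w + w)%C with (circle a) in H by ring.
      rewrite Cmod_circle in H; lra. }
    assert (Hi : / Cmod (circle a - w) <= 2).
    { rewrite <- (Rinv_inv 2); apply Rinv_le_contravar; lra. }
    pose proof (HM a Ha); pose proof (Cmod_ge_0 (g a)).
    assert (0 < / Cmod (circle a - w)) by (apply Rinv_0_lt_compat; lra).
    nra.
Qed.

Lemma Ccontinuous_bounded (g : R -> C) (a b : R) :
  a <= b -> (forall t, Ccontinuous g t) ->
  exists M, forall t, a <= t <= b -> Cmod (g t) <= M.
Proof.
  intros Hab Hg.
  destruct (continuity_ab_maj (fun t => Rabs (Re (g t)) + Rabs (Im (g t))) a b Hab)
    as [m [Hm _]].
  - intros t _; apply continuity_pt_filterlim.
    apply (continuous_plus (K := R_AbsRing) (V := R_NormedModule)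
             (fun t => Rabs (Re (g t))) (fun t => Rabs (Im (g t))) t).
    + apply (continuous_comp (fun t => Re (g t)) Rabs); [apply Hg|apply continuous_Rabs].
    + apply (continuous_comp (fun t => Im (g t)) Rabs); [apply Hg|apply continuous_Rabs].
  - exists (Rabs (Re (g m)) + Rabs (Im (g m))); intros t Ht.
    eapply Rle_trans; [apply Cmod_le_Rabs|now apply Hm].
Qed.

(** The integral equals [2 pi] for every [w] of modulus less than 1. Its being
    nonzero near 0 is enough to divide by it, and this follows from one
    expansion step applied to the constant function 1. *)
Lemma kernel_int_neq_0 (w : C) :
  Cmod w < 1/4 -> circle_int (fun a => circle a / (circle a - w))%C <> 0%C.
Proof.
  intros Hw E; pose proof PI_RGT_0.
  assert (H1 : forall a : R, Ccontinuous (fun _ : R => 1%C) a)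
    by (intros a; apply Ccontinuous_const).
  assert (HE : remainder (fun _ => 1%C) 0 w = 0%C).
  { rewrite <- E; apply circle_int_ext; intros a; simpl; now rewrite !Cmult_1_l. }
  rewrite remainder_step in HE by (assumption || lra).
  assert (Hc : coeff (fun _ => 1%C) 0 = RtoC (2 * PI)).
  { unfold coeff, circle_int; apply injective_projections; simpl.
    - rewrite (RInt_ext _ (fun _ => 1)) by (intros; simpl; ring).
      rewrite RInt_const; unfold scal; simpl; unfold mult; simpl; ring.
    - rewrite (RInt_ext _ (fun _ => 0)) by (intros; simpl; ring).
      rewrite RInt_const; unfold scal; simpl; unfold mult; simpl; ring. }
  rewrite Hc in HE.
  assert (HB : Cmod (remainder (fun _ => 1%C) 1 w) <= 4 * PI * (2 * 1)).
  { apply remainder_bound; [exact H1| |lra]; intros a _; rewrite Cmod_1; lra. }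
  assert (Hn : RtoC (2 * PI) = (- (w * remainder (fun _ => 1%C) 1 w))%C).
  { transitivity (RtoC (2 * PI) + w * remainder (fun _ => 1%C) 1 w
                  - w * remainder (fun _ => 1%C) 1 w)%C; [ring|rewrite HE; ring]. }
  apply (f_equal Cmod) in Hn.
  rewrite Cmod_opp, Cmod_mult, Cmod_R, Rabs_right in Hn by lra.
  pose proof (Cmod_ge_0 w); nra.
Qed.

Lemma zero_of_geometric_bound (x K r : R) :
  0 <= x -> 0 <= r < 1 -> (forall n, x <= K * r ^ n) -> x = 0.
Proof.
  intros Hx Hr H.
  apply Rle_antisym; [|exact Hx].
  apply Rnot_lt_le; intros Hpos.
  assert (HK : 0 < K) by (specialize (H 0%nat); simpl in H; lra).
  destruct (pow_lt_1_zero r (Rabs_def1 r 1 ltac:(lra) ltac:(lra)) (x / K)) as [N HN].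
  { now apply Rdiv_lt_0_compat. }
  specialize (HN N (le_n N)); specialize (H N).
  rewrite Rabs_right in HN by (apply Rle_ge, pow_le; lra).
  apply (Rmult_lt_compat_l K) in HN; [|exact HK].
  replace (K * (x / K)) with x in HN by (field; lra); lra.
Qed.

Lemma least_nat (P : nat -> Prop) (n : nat) :
  P n -> exists m, P m /\ forall k, (k < m)%nat -> ~ P k.
Proof.
  induction n as [n IH] using (well_founded_induction Wf_nat.lt_wf); intros Hn.
  destruct (classic (exists k, (k < n)%nat /\ P k)) as [[k [Hk Pk]]|H].
  - exact (IH k Hk Pk).
  - exists n; split; [exact Hn|]; intros k Hk Pk; apply H; now exists k.
Qed.

(** If some Taylor coefficient is nonzero, the first such one, [c_n], gives
    [F(w) K(w) = w^n (c_n + w R(w))] with [R] bounded and [K] the nonvanishing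
    kernel integral, so that [F] has no zero close to 0 except possibly 0. If
    all vanish, then [|F(w) K(w)| <= B |w|^n] for all [n]. *)
Lemma zeros_unit_disc (F F' : C -> C) :
  holomorphic (fun z => Cmod z < 2) F F' ->
  exists r, 0 < r /\
    ((forall z, Cmod z < r -> F z = 0%C) \/
     (forall z, Cmod z < r -> z <> 0%C -> F z <> 0%C)).
Proof.
  intros HF; pose proof PI_RGT_0.
  set (g := fun a => F (circle a)).
  assert (Hg : forall a, Ccontinuous g a).
  { intros a.
    assert (Ha : Cmod (circle a) < 2) by (rewrite Cmod_circle; lra).
    destruct (HF (circle a) Ha) as [F1 _].
    exact (path_derive_continuous _ _ _ (F1 circle a _ eq_refl (circle_derive a))). }
  destruct (Ccontinuous_bounded g 0 (2 * PI) ltac:(lra) Hg) as [M HM].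
  assert (HM0 : 0 <= M).
  { eapply Rle_trans; [apply (Cmod_ge_0 (g 0))|apply HM; lra]. }
  assert (Hcauchy : forall w, Cmod w < 1 ->
    remainder g 0 w = (F w * circle_int (fun a => circle a / (circle a - w)))%C).
  { intros w Hw; rewrite <- (cauchy_formula F F' w HF Hw).
    apply circle_int_ext; intros a; simpl; unfold g; ring. }
  destruct (classic (exists n, coeff g n <> 0%C)) as [[n0 Hn0]|Hall].
  - destruct (least_nat (fun n => coeff g n <> 0%C) n0 Hn0) as [n [Hn Hmin]].
    set (B := 4 * PI * (2 * M)).
    assert (HB : 0 <= B) by (unfold B; nra).
    assert (Hc : 0 < Cmod (coeff g n)) by now apply Cmod_gt_0.
    exists (Rmin (1/4) (Cmod (coeff g n) / (B + 1))); split.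
    { apply Rmin_glb_lt; [lra|apply Rdiv_lt_0_compat; lra]. }
    right; intros w Hw Hw0 Fw.
    assert (Hw1 : Cmod w < 1/4) by (eapply Rlt_le_trans; [exact Hw|apply Rmin_l]).
    assert (Hw2 : Cmod w * (B + 1) < Cmod (coeff g n)).
    { pose proof (Rlt_le_trans _ _ _ Hw (Rmin_r _ _)) as Hw'.
      apply (Rmult_lt_compat_r (B + 1)) in Hw'; [|lra].
      unfold Rdiv in Hw'; rewrite Rmult_assoc, Rinv_l in Hw'; lra. }
    assert (E : (w ^ n * remainder g n w)%C = 0%C).
    { rewrite <- remainder_pow; [|exact Hg|lra|].
      - rewrite Hcauchy by lra; rewrite Fw; ring.
      - intros k Hk; apply NNPP; exact (Hmin k Hk). }
    assert (E' : remainder g n w = 0%C).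
    { apply NNPP; intros Hne; revert E; apply Cmult_neq_0; [|exact Hne].
      now apply Cpow_nz. }
    rewrite (remainder_step g n w Hg) in E' by lra.
    assert (Hn' : coeff g n = (- (w * remainder g (S n) w))%C).
    { transitivity (coeff g n + w * remainder g (S n) w
                    - w * remainder g (S n) w)%C; [ring|rewrite E'; ring]. }
    apply (f_equal Cmod) in Hn'; rewrite Cmod_opp, Cmod_mult in Hn'.
    pose proof (remainder_bound g M (S n) w Hg HM ltac:(lra)) as Hb; fold B in Hb.
    pose proof (Cmod_ge_0 w); nra.
  - exists (1/4); split; [lra|]; left; intros w Hw.
    assert (E : remainder g 0 w = 0%C).
    { apply Cmod_eq_0.
      apply (zero_of_geometric_bound _ (4 * PI * (2 * M)) (Cmod w)).
      - apply Cmod_ge_0.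
      - pose proof (Cmod_ge_0 w); lra.
      - intros n; rewrite (remainder_pow g n w Hg) by
          (lra || (intros k _; apply NNPP; intros Hk; apply Hall; now exists k)).
        rewrite Cmod_mult, Cmod_pow.
        pose proof (remainder_bound g M n w Hg HM ltac:(lra)).
        assert (0 <= Cmod w ^ n) by apply pow_le, Cmod_ge_0; nra. }
    rewrite Hcauchy in E by lra.
    apply NNPP; intros Hne; revert E; apply Cmult_neq_0; [exact Hne|].
    now apply kernel_int_neq_0.
Qed.

Lemma Cminus_eq_0 (w z : C) : (w - z)%C = 0%C -> w = z.
Proof.
  intros E; transitivity (w - z + z)%C; [ring|rewrite E; ring].
Qed.

Lemma open_Cdisc (D : R * R -> Prop) (z : R * R) :
  open D -> D z -> exists r, 0 < r /\ forall w : C, Cmod (w - z) < r -> D w.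
Proof.
  intros HD Dz; destruct (HD z Dz) as [r Hr].
  exists r; split; [apply cond_pos|]; intros w Hw; apply Hr; split.
  - eapply Rle_lt_trans; [exact (re_le_Cmod (w - z)%C)|exact Hw].
  - eapply Rle_lt_trans; [exact (im_le_Cmod (w - z)%C)|exact Hw].
Qed.

Lemma Cdisc_open (z : C) (r : R) :
  open (fun w : R * R => Cmod ((w : C) - z) < r).
Proof.
  intros w Hw.
  assert (He : 0 < (r - Cmod ((w : C) - z)) / 2) by lra.
  exists (mkposreal _ He); intros w' [H1 H2].
  replace (w' - z)%C with ((w' - w) + (w - z))%C by ring.
  eapply Rle_lt_trans; [apply Cmod_triangle|].
  eapply Rle_lt_trans; [apply Rplus_le_compat_r, Cmod_le_Rabs|].
  change (Rabs (Re (w' - w)%C) < (r - Cmod ((w : C) - z)) / 2) in H1.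
  change (Rabs (Im (w' - w)%C) < (r - Cmod ((w : C) - z)) / 2) in H2.
  lra.
Qed.

Lemma zeros_local (D : R * R -> Prop) (F F' : C -> C) (z : C) :
  open D -> holomorphic D F F' -> D z ->
  exists r, 0 < r /\
    ((forall w, Cmod (w - z) < r -> F w = 0%C) \/
     (forall w, Cmod (w - z) < r -> w <> z -> F w <> 0%C)).
Proof.
  intros HD HF Dz.
  destruct (open_Cdisc D z HD Dz) as [r [Hr HDr]].
  assert (Hr2 : RtoC (r / 2) <> 0%C) by (intros E; apply RtoC_inj in E; lra).
  destruct (zeros_unit_disc (fun u => F (z + RtoC (r / 2) * u))%C
              (fun u => F' (z + RtoC (r / 2) * u) * RtoC (r / 2))%C) as [s [Hs H]].
  { apply (holomorphic_affine D); [|exact HF].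
    intros u Hu; apply HDr.
    replace (z + RtoC (r / 2) * u - z)%C with (RtoC (r / 2) * u)%C by ring.
    rewrite Cmod_mult, Cmod_R, Rabs_right; nra. }
  assert (Hsc : forall w, Cmod (w - z) < r / 2 * s -> Cmod ((w - z) / RtoC (r / 2)) < s).
  { intros w Hw; unfold Cdiv.
    rewrite Cmod_mult, Cmod_inv, Cmod_R, Rabs_right by (assumption || lra).
    apply (Rmult_lt_reg_l (r / 2)); [lra|].
    replace (r / 2 * (Cmod (w - z) * / (r / 2))) with (Cmod (w - z)) by (field; lra).
    exact Hw. }
  assert (Hback : forall w, (z + RtoC (r / 2) * ((w - z) / RtoC (r / 2)))%C = w).
  { intros w; field; exact Hr2. }
  exists (r / 2 * s); split; [nra|].
  destruct H as [H|H]; [left|right]; intros w Hw.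
  - rewrite <- (Hback w); now apply H, Hsc.
  - intros Hne; rewrite <- (Hback w); apply H; [now apply Hsc|].
    intros E; apply Hne; rewrite <- (Hback w), E; ring.
Qed.

(** The points near which [F] vanishes and the points with a punctured
    neighbourhood free of zeros form two disjoint open sets, which cover [D] by
    the local dichotomy; connectedness leaves only one of them. *)
Lemma identity_theorem (D : R * R -> Prop) (F F' : C -> C) :
  Defs.domain D -> holomorphic D F F' ->
  (forall z, D z -> F z = 0%C) \/
  (forall z, D z -> exists r, 0 < r /\
     forall w, Cmod (w - z) < r -> w <> z -> F w <> 0%C).
Proof.
  intros [HD Hconn] HF.
  set (U := fun z : R * R => exists r, 0 < r /\
              forall w : C, Cmod (w - z) < r -> F w = 0%C).
  set (V := fun z : R * R => exists r, 0 < r /\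
              forall w : C, Cmod (w - z) < r -> w <> z -> F w <> 0%C).
  assert (HUV : forall z, D z -> U z \/ V z).
  { intros z Dz; destruct (zeros_local D F F' z HD HF Dz) as [r [Hr [H|H]]];
      [left|right]; exists r; now split. }
  assert (Hdisj : forall z, U z -> V z -> False).
  { intros z [r [Hr HU]] [s [Hs HV]].
    set (e := Rmin r s / 2).
    assert (He : 0 < e) by (unfold e; pose proof (Rmin_glb_lt r s 0 Hr Hs); lra).
    assert (He1 : e < r) by (unfold e; pose proof (Rmin_l r s); pose proof (Rmin_glb_lt r s 0 Hr Hs); lra).
    assert (He2 : e < s) by (unfold e; pose proof (Rmin_r r s); pose proof (Rmin_glb_lt r s 0 Hr Hs); lra).
    assert (Hd : Cmod ((z : C) + RtoC e - z) = e).
    { replace ((z : C) + RtoC e - z)%C with (RtoC e) by ring.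
      rewrite Cmod_R; apply Rabs_right; lra. }
    apply (HV ((z : C) + RtoC e)%C); [lra| |apply HU; lra].
    intros E; rewrite E in Hd; replace ((z : C) - z)%C with (RtoC 0) in Hd by ring.
    rewrite Cmod_0 in Hd; lra. }
  assert (HU : open U).
  { intros z [r [Hr H]].
    apply (filter_imp (fun w : R * R => Cmod ((w : C) - z) < r / 2)).
    - intros w Hw; exists (r / 2); split; [lra|]; intros w' Hw'; apply H.
      replace (w' - z)%C with ((w' - w) + (w - z))%C by ring.
      eapply Rle_lt_trans; [apply Cmod_triangle|lra].
    - apply Cdisc_open.
      replace ((z : C) - z)%C with (RtoC 0) by ring; rewrite Cmod_0; lra. }
  assert (HV : open V).
  { intros z [r [Hr H]].
    apply (filter_imp (fun w : R * R => Cmod ((w : C) - z) < r / 2)).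
    - intros w Hw.
      destruct (classic (w = z)) as [->|Hne]; [exists r; now split|].
      assert (Hp : 0 < Cmod ((w : C) - z)).
      { apply Cmod_gt_0; intros E; exact (Hne (Cminus_eq_0 w z E)). }
      exists (Cmod ((w : C) - z)); split; [exact Hp|].
      intros w' Hw' _; apply H.
      + replace (w' - z)%C with ((w' - w) + (w - z))%C by ring.
        eapply Rle_lt_trans; [apply Cmod_triangle|lra].
      + intros ->; revert Hw'.
        replace ((z : C) - w)%C with (- (w - z))%C by ring.
        rewrite Cmod_opp; lra.
    - apply Cdisc_open.
      replace ((z : C) - z)%C with (RtoC 0) by ring; rewrite Cmod_0; lra. }
  destruct (classic (exists z, D z /\ U z)) as [HexU|HnoU].
  - left; intros z Dz.
    destruct (HUV z Dz) as [[r [Hr H]]|Vz].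
    + apply H; replace ((z : C) - z)%C with (RtoC 0) by ring; rewrite Cmod_0; lra.
    + destruct (Hconn U V HU HV HUV HexU (ex_intro _ z (conj Dz Vz)))
        as [p [_ [Up Vp]]].
      destruct (Hdisj p Up Vp).
  - right; intros z Dz; destruct (HUV z Dz) as [Uz|Vz]; [|exact Vz].
    destruct HnoU; now exists z.
Qed.

Lemma zero_of_zero_on_reals (D : R * R -> Prop) (F F' : C -> C) (x0 : R) :
  Defs.domain D -> holomorphic D F F' -> D (x0, 0) ->
  (forall x, D (x, 0) -> F (x, 0) = 0%C) ->
  forall z, D z -> F z = 0%C.
Proof.
  intros HD HF D0 Hreal.
  destruct (identity_theorem D F F' HD HF) as [H|H]; [exact H|exfalso].
  destruct (H _ D0) as [r [Hr Hnz]].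
  destruct (open_Cdisc D (x0, 0) (proj1 HD) D0) as [s [Hs HDs]].
  set (e := Rmin r s / 2).
  assert (Hm : 0 < Rmin r s) by now apply Rmin_glb_lt.
  assert (He : Cmod (((x0 + e)%R, 0%R) - (x0, 0%R))%C = e).
  { replace (((x0 + e)%R, 0%R) - (x0, 0%R))%C with (RtoC e)
      by (apply injective_projections; simpl; ring).
    rewrite Cmod_R; apply Rabs_right; unfold e; lra. }
  apply (Hnz ((x0 + e)%R, 0%R)).
  - rewrite He; unfold e; pose proof (Rmin_l r s); lra.
  - intros E; injection E; unfold e; lra.
  - apply Hreal, HDs; rewrite He; unfold e; pose proof (Rmin_r r s); lra.
Qed.

(** * Quaternions and stem functions *)

Definition q_re (q : quat) : R := fst (fst (fst q)).
Definition q_i (q : quat) : R := snd (fst (fst q)).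
Definition q_j (q : quat) : R := snd (fst q).
Definition q_k (q : quat) : R := snd q.

Definition dot (v q : quat) : R :=
  q_re v * q_re q + q_i v * q_i q + q_j v * q_j q + q_k v * q_k q.

Definition unit_i : quat := (0, 1, 0, 0).

(** Reduces the abstract module operations on quaternions to real arithmetic on
    coordinates. The unfolding is repeated because the instances appear only
    after the projections have been simplified. *)
Ltac quat_unfold :=
  unfold dot, q_re, q_i, q_j, q_k, unit_i, qmult, RtoQuat, zero, plus, opp,
    minus, scal in *;
  simpl in *; unfold plus, zero, opp, scal in *; simpl in *; unfold mult in *; simpl in *.

Lemma dot_plus (v p q : quat) : dot v (plus p q) = dot v p + dot v q.
Proof. destruct v as [[[? ?] ?] ?], p as [[[? ?] ?] ?], q as [[[? ?] ?] ?]; quat_unfold; ring. Qed.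

Lemma dot_opp (v q : quat) : dot v (opp q) = - dot v q.
Proof. destruct v as [[[? ?] ?] ?], q as [[[? ?] ?] ?]; quat_unfold; ring. Qed.

Lemma dot_scal (v q : quat) (k : R) : dot v (scal k q) = k * dot v q.
Proof. destruct v as [[[? ?] ?] ?], q as [[[? ?] ?] ?]; quat_unfold; ring. Qed.

Lemma dot_zero (v : quat) : dot v zero = 0.
Proof. destruct v as [[[? ?] ?] ?]; quat_unfold; ring. Qed.

Lemma quat_ext (p q : quat) :
  q_re p = q_re q -> q_i p = q_i q -> q_j p = q_j q -> q_k p = q_k q -> p = q.
Proof.
  destruct p as [[[? ?] ?] ?], q as [[[? ?] ?] ?].
  unfold q_re, q_i, q_j, q_k; simpl; now intros -> -> -> ->.
Qed.

Lemma dot_ext (p q : quat) : (forall v, dot v p = dot v q) -> p = q.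
Proof.
  intros H.
  pose proof (H (1, 0, 0, 0)) as H0; pose proof (H (0, 1, 0, 0)) as H1;
    pose proof (H (0, 0, 1, 0)) as H2; pose proof (H (0, 0, 0, 1)) as H3.
  clear H; apply quat_ext; quat_unfold; lra.
Qed.

Lemma imaginary_unit_coords (I : quat) :
  imaginary_unit I <->
  exists b c d, I = (0, b, c, d) /\ b * b + c * c + d * d = 1.
Proof.
  split.
  - destruct I as [[[a b] c] d]; unfold imaginary_unit, qmult, RtoQuat.
    intros E; injection E; intros E3 E2 E1 E0.
    assert (a = 0).
    { destruct (Req_dec a 0) as [Ha|Ha]; [exact Ha|exfalso].
      assert (b = 0) by (apply Rmult_eq_reg_l with a; lra).
      assert (c = 0) by (apply Rmult_eq_reg_l with a; lra).
      assert (d = 0) by (apply Rmult_eq_reg_l with a; lra).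
      subst; nra. }
    subst a; exists b, c, d; split; [reflexivity|lra].
  - intros (b & c & d & -> & E); unfold imaginary_unit.
    apply quat_ext; quat_unfold; lra.
Qed.

Lemma unit_i_imaginary : imaginary_unit unit_i.
Proof. apply imaginary_unit_coords; exists 1, 0, 0; split; [reflexivity|ring]. Qed.

Lemma qpoint_coords (b c d x y : R) :
  qpoint (0, b, c, d) x y = (x, y * b, y * c, y * d).
Proof. unfold qpoint; apply quat_ext; quat_unfold; ring. Qed.

Lemma qpoint_real (I : quat) (x : R) : imaginary_unit I -> qpoint I x 0 = RtoQuat x.
Proof.
  intros H; apply imaginary_unit_coords in H; destruct H as (b & c & d & -> & _).
  rewrite qpoint_coords; apply quat_ext; quat_unfold; ring.
Qed.

Lemma dot_qmult (I v q : quat) :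
  imaginary_unit I -> dot v (qmult I q) = - dot (qmult I v) q.
Proof.
  intros H; apply imaginary_unit_coords in H; destruct H as (b & c & d & -> & _).
  destruct v as [[[? ?] ?] ?], q as [[[? ?] ?] ?]; quat_unfold; ring.
Qed.

Lemma qmult_imaginary_twice (I q : quat) :
  imaginary_unit I -> qmult I (qmult I q) = opp q.
Proof.
  intros H; apply imaginary_unit_coords in H; destruct H as (b & c & d & -> & E).
  destruct q as [[[q0 q1] q2] q3].
  assert (E0 : d * d = 1 - b * b - c * c) by lra.
  apply quat_ext; quat_unfold; nsatz.
Qed.

Lemma is_linear_combination {U : NormedModule R_AbsRing} (f g : U -> R) (a : R) :
  is_linear (V := R_NormedModule) f -> is_linear (V := R_NormedModule) g ->
  is_linear (V := R_NormedModule) (fun q => f q + a * g q).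
Proof.
  intros Hf Hg.
  assert (Hag : is_linear (V := R_NormedModule) (fun q => a * g q)).
  { apply (is_linear_comp (V := R_NormedModule) g (fun y => scal a y)); [exact Hg|].
    exact (is_linear_scal_r (K := R_AbsRing) (V := R_NormedModule) a Rmult_comm). }
  apply (is_linear_comp (V := prod_NormedModule _ R_NormedModule R_NormedModule)
           (fun q => (f q, a * g q)) (fun z => plus (fst z) (snd z))).
  - now apply (is_linear_prod (U := R_NormedModule) (V := R_NormedModule)).
  - apply (is_linear_plus (V := R_NormedModule)).
Qed.

Lemma dot_linear (v : quat) :
  is_linear (K := R_AbsRing) (U := quat_NormedModule) (V := R_NormedModule) (dot v).
Proof.
  assert (H3 : is_linear (K := R_AbsRing) (U := quat_NormedModule)
                 (V := R_NormedModule) q_k) by apply is_linear_snd.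
  pose (P2 := prod_NormedModule R_AbsRing R_NormedModule R_NormedModule).
  pose (P3 := prod_NormedModule R_AbsRing P2 R_NormedModule).
  assert (L3 : is_linear (K := R_AbsRing) (U := quat_NormedModule) (V := P3)
                 (fun q : quat => fst q)) by apply is_linear_fst.
  assert (H2 : is_linear (K := R_AbsRing) (U := quat_NormedModule)
                 (V := R_NormedModule) q_j).
  { apply (is_linear_comp (V := P3) (fun q : quat => fst q) (fun q => snd q));
      [exact L3|apply is_linear_snd]. }
  assert (L2 : is_linear (K := R_AbsRing) (U := quat_NormedModule) (V := P2)
                 (fun q : quat => fst (fst q))).
  { apply (is_linear_comp (V := P3) (fun q : quat => fst q) (fun q => fst q));
      [exact L3|apply is_linear_fst]. }
  assert (H1 : is_linear (K := R_AbsRing) (U := quat_NormedModule)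
                 (V := R_NormedModule) q_i).
  { apply (is_linear_comp (V := P2) (fun q : quat => fst (fst q)) (fun q => snd q));
      [exact L2|apply is_linear_snd]. }
  assert (H0 : is_linear (K := R_AbsRing) (U := quat_NormedModule)
                 (V := R_NormedModule) q_re).
  { apply (is_linear_comp (V := P2) (fun q : quat => fst (fst q)) (fun q => fst q));
      [exact L2|apply is_linear_fst]. }
  assert (E : forall q, 0 + q_re v * q_re q + q_i v * q_i q + q_j v * q_j q
                        + q_k v * q_k q = dot v q) by (intros q; unfold dot; ring).
  apply (is_linear_ext (V := R_NormedModule) _ _ E).
  repeat apply is_linear_combination; try assumption.
  apply (is_linear_zero (V := R_NormedModule)).
Qed.

Lemma dot_derive (v : quat) (F : R -> quat) (t : R) (l : quat) :
  is_derive F t l -> is_derive (fun s => dot v (F s)) t (dot v l).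
Proof.
  intros HF; unfold is_derive.
  apply (filterdiff_ext_lin _ (fun y : R => dot v (scal y l))).
  - apply (filterdiff_comp' (V := quat_NormedModule) F (dot v) t
             (fun y => scal y l) (dot v)); [exact HF|].
    apply filterdiff_linear, dot_linear.
  - intros y; apply dot_scal.
Qed.

Lemma dot_continuous {T : UniformSpace} (v : quat) (F : T -> quat) (p : T) :
  continuous F p -> continuous (fun s => dot v (F s)) p.
Proof.
  intros HF; apply (continuous_comp F (dot v)); [exact HF|].
  apply (linear_cont (U := quat_NormedModule) (V := R_NormedModule)), dot_linear.
Qed.

(** The map [q |-> <v, q> + i <Iv, q>] intertwines left multiplication by [I]
    with multiplication by the complex unit, because
    [<v, Iq> = - <Iv, q>] and [I^2 = -1]. It therefore turns solutions of the
    Cauchy-Riemann equation of [L_I] into holomorphic functions. Letting [v] vary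
    recovers the whole quaternion, without choosing a splitting of the algebra
    adapted to [I]. *)
Lemma holomorphic_on_component (I : quat) (D : R * R -> Prop) (F : R * R -> quat) (v : quat) :
  imaginary_unit I -> open D -> holomorphic_on I D F ->
  exists F', holomorphic D (fun z => (dot v (F z), dot (qmult I v) (F z))) F'.
Proof.
  intros HI HD [Fx [Fy H]].
  assert (CR : forall z, D z -> Fx z = opp (qmult I (Fy z))).
  { intros [x y] Dz; destruct (H x y Dz) as (_ & _ & _ & _ & E).
    apply dot_ext; intros w; apply (f_equal (dot w)) in E.
    rewrite dot_scal, dot_plus, dot_zero in E; rewrite dot_opp; lra. }
  exists (fun z => (dot v (Fx z), dot (qmult I v) (Fx z))).
  apply (cauchy_riemann_holomorphic D (fun z => dot v (F z))
           (fun z => dot (qmult I v) (F z)) (fun z => dot v (Fx z))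
           (fun z => dot v (Fy z)) (fun z => dot (qmult I v) (Fx z))
           (fun z => dot (qmult I v) (Fy z)) HD).
  - intros x y Dz; destruct (H x y Dz) as (H1 & H2 & H3 & _).
    split; [|split].
    + exact (dot_derive v _ _ _ H1).
    + exact (dot_derive v _ _ _ H2).
    + exact (dot_continuous v Fx _ H3).
  - intros x y Dz; destruct (H x y Dz) as (H1 & H2 & H3 & _).
    split; [|split].
    + exact (dot_derive (qmult I v) _ _ _ H1).
    + exact (dot_derive (qmult I v) _ _ _ H2).
    + exact (dot_continuous (qmult I v) Fx _ H3).
  - intros z Dz; rewrite (CR z Dz), !dot_opp, !dot_qmult by exact HI.
    rewrite (qmult_imaginary_twice I v HI).
    assert (E : forall q, dot (opp v) q = - dot v q).
    { intros q; destruct v as [[[? ?] ?] ?], q as [[[? ?] ?] ?]; quat_unfold; ring. }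
    rewrite E; split; ring.
Qed.

(** The coordinates [(x, y)], with [y >= 0], of the unique sphere [x + y S]
    through [q]. *)
Definition polar (q : quat) : R * R :=
  (q_re q, sqrt (q_i q * q_i q + q_j q * q_j q + q_k q * q_k q)).

Lemma polar_spec (q : quat) :
  exists J, imaginary_unit J /\ q = qpoint J (fst (polar q)) (snd (polar q)).
Proof.
  destruct q as [[[a b] c] d]; unfold polar, q_re, q_i, q_j, q_k; cbn [fst snd].
  assert (Hn : 0 <= b * b + c * c + d * d) by nra.
  pose proof (sqrt_sqrt _ Hn) as Hs.
  set (y := sqrt (b * b + c * c + d * d)) in *.
  destruct (Req_dec y 0) as [Hy|Hy].
  - exists unit_i; split; [exact unit_i_imaginary|].
    rewrite Hy in Hs |- *.
    assert (b = 0) by nra; assert (c = 0) by nra; assert (d = 0) by nra; subst.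
    unfold unit_i; rewrite qpoint_coords; apply quat_ext; quat_unfold; ring.
  - exists (0, b / y, c / y, d / y); split.
    + apply imaginary_unit_coords; exists (b / y), (c / y), (d / y).
      split; [reflexivity|].
      transitivity ((b * b + c * c + d * d) / (y * y)); [field; exact Hy|].
      rewrite <- Hs; field; exact Hy.
    + rewrite qpoint_coords; apply quat_ext; quat_unfold; field; exact Hy.
Qed.

Lemma polar_qpoint (J : quat) (x y : R) :
  imaginary_unit J -> 0 <= y -> polar (qpoint J x y) = (x, y).
Proof.
  intros HJ Hy; apply imaginary_unit_coords in HJ; destruct HJ as (b & c & d & -> & E).
  rewrite qpoint_coords; unfold polar, q_re, q_i, q_j, q_k; cbn [fst snd].
  f_equal.
  replace (y * b * (y * b) + y * c * (y * c) + y * d * (y * d))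
    with (y * y * (b * b + c * c + d * d)) by ring.
  rewrite E, Rmult_1_r; now apply sqrt_square.
Qed.

Lemma polar_continuous (q : quat) : continuous polar q.
Proof.
  assert (Hdot : forall v, continuous (dot v) q)
    by (intros v; apply (dot_continuous v (fun p => p)), continuous_id).
  assert (H0 : continuous q_re q).
  { apply (continuous_ext (dot (1, 0, 0, 0))); [|apply Hdot].
    intros p; quat_unfold; ring. }
  assert (H1 : continuous q_i q).
  { apply (continuous_ext (dot (0, 1, 0, 0))); [|apply Hdot].
    intros p; quat_unfold; ring. }
  assert (H2 : continuous q_j q).
  { apply (continuous_ext (dot (0, 0, 1, 0))); [|apply Hdot].
    intros p; quat_unfold; ring. }
  assert (H3 : continuous q_k q).
  { apply (continuous_ext (dot (0, 0, 0, 1))); [|apply Hdot].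
    intros p; quat_unfold; ring. }
  apply (continuous_comp_2 q_re
           (fun p => sqrt (q_i p * q_i p + q_j p * q_j p + q_k p * q_k p))
           (fun a b => (a, b)) q H0).
  - apply (continuous_comp (fun p => q_i p * q_i p + q_j p * q_j p + q_k p * q_k p) sqrt).
    + apply (continuous_plus (K := R_AbsRing) (V := R_NormedModule)
               (fun p => q_i p * q_i p + q_j p * q_j p) (fun p => q_k p * q_k p)).
      * apply (continuous_plus (K := R_AbsRing) (V := R_NormedModule)
                 (fun p => q_i p * q_i p) (fun p => q_j p * q_j p));
          now apply (continuous_mult (K := R_AbsRing)).
      * now apply (continuous_mult (K := R_AbsRing)).
    + apply continuous_sqrt.
  - apply (continuous_ext (fun z => z)); [|apply continuous_id].
    intros z; apply surjective_pairing.
Qed.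

(** The norm of quaternions is multiplicative. *)
Lemma qmult_cancel (p q : quat) : p <> zero -> qmult p q = zero -> q = zero.
Proof.
  intros Hp E.
  assert (Hpos : forall q, dot q q = 0 -> q = zero).
  { intros [[[a b] c] d] H; quat_unfold.
    assert (a = 0) by nra; assert (b = 0) by nra;
      assert (c = 0) by nra; assert (d = 0) by nra; now subst. }
  assert (Hmul : dot (qmult p q) (qmult p q) = dot p p * dot q q).
  { destruct p as [[[? ?] ?] ?], q as [[[? ?] ?] ?]; quat_unfold; ring. }
  rewrite E, dot_zero in Hmul.
  destruct (Rmult_integral _ _ (eq_sym Hmul)) as [H|H]; [|now apply Hpos].
  destruct (Hp (Hpos p H)).
Qed.

Lemma qmult_minus_l (p q r : quat) :
  qmult (minus p q) r = minus (qmult p r) (qmult q r).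
Proof.
  destruct p as [[[? ?] ?] ?], q as [[[? ?] ?] ?], r as [[[? ?] ?] ?].
  apply quat_ext; quat_unfold; ring.
Qed.

(** * The representation formula *)

(** The functions [b] and [c] with [f(x + yi) = b + ic] and
    [f(x - yi) = b - ic]. *)
Definition slice_even (f : quat -> quat) (z : R * R) : quat :=
  scal (/ 2) (plus (f (qpoint unit_i (fst z) (snd z)))
                   (f (qpoint unit_i (fst z) (- snd z)))).

Definition slice_odd (f : quat -> quat) (z : R * R) : quat :=
  scal (/ 2) (qmult unit_i (minus (f (qpoint unit_i (fst z) (- snd z)))
                                  (f (qpoint unit_i (fst z) (snd z))))).

Definition stem (f : quat -> quat) (v : quat) (z : C) : C :=
  (dot v (slice_even f z), dot v (slice_odd f z)).

Lemma slice_symmetric (Omega : quat -> Prop) (I J : quat) (z : R * R) :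
  symmetric Omega -> imaginary_unit I -> imaginary_unit J ->
  slice Omega I z -> slice Omega J z.
Proof.
  intros Hs HI HJ Hz; apply (Hs (fst z) (snd z) I HI Hz); now exists J.
Qed.

Lemma slice_conj (Omega : quat -> Prop) (z : R * R) :
  symmetric Omega -> slice Omega unit_i z -> slice Omega unit_i (Cconj z).
Proof.
  intros Hs Hz; apply (Hs (fst z) (snd z) unit_i unit_i_imaginary Hz).
  exists (0, -1, 0, 0); split.
  - apply imaginary_unit_coords; exists (-1), 0, 0; split; [reflexivity|ring].
  - unfold unit_i; rewrite !qpoint_coords; simpl.
    apply quat_ext; quat_unfold; ring.
Qed.

Section Stem.
Variables (Omega : quat -> Prop) (f : quat -> quat).
Hypothesis Hslice : slice_domain Omega.
Hypothesis Hsym : symmetric Omega.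
Hypothesis Hreg : regular Omega f.

Let D := slice Omega unit_i.

Lemma base_domain : Defs.domain D.
Proof. exact (proj2 (proj2 Hslice) unit_i unit_i_imaginary). Qed.

Lemma base_meets_reals : exists x, D (x, 0).
Proof.
  destruct (proj1 (proj2 Hslice)) as [x Hx]; exists x.
  unfold D, slice; simpl; now rewrite (qpoint_real _ _ unit_i_imaginary).
Qed.

(** If [g] is the holomorphic component [<v, f> + i <iv, f>] of [f] on the base
    slice, the stem function is the average of [g z] and [conj (g (conj z))]. *)
Lemma stem_holomorphic (v : quat) : exists F', holomorphic D (stem f v) F'.
Proof.
  destruct (holomorphic_on_component unit_i D _ v unit_i_imaginary
              (proj1 base_domain) (Hreg unit_i unit_i_imaginary)) as [F' HF].
  eexists.
  eapply holomorphic_ext;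
    [|exact (holomorphic_mult D _ _ _ _ (holomorphic_const D (RtoC (/ 2)))
        (holomorphic_plus D _ _ _ _ HF
           (holomorphic_conj D _ _ (fun z => slice_conj Omega z Hsym) HF)))].
  intros [x y]; unfold stem, slice_even, slice_odd, Cconj; cbn [fst snd].
  rewrite !dot_scal, !dot_plus, (dot_qmult _ _ _ unit_i_imaginary).
  unfold minus; rewrite dot_plus, dot_opp.
  apply injective_projections; simpl; ring.
Qed.

Lemma slice_odd_real (x : R) : slice_odd f (x, 0) = zero.
Proof.
  apply dot_ext; intros v; unfold slice_odd; cbn [fst snd].
  rewrite Ropp_0, dot_scal, (dot_qmult _ _ _ unit_i_imaginary).
  unfold minus; rewrite dot_plus, dot_opp, dot_zero; ring.
Qed.

Lemma slice_even_real (x : R) : slice_even f (x, 0) = f (RtoQuat x).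
Proof.
  apply dot_ext; intros v; unfold slice_even; cbn [fst snd].
  rewrite Ropp_0, (qpoint_real _ _ unit_i_imaginary), dot_scal, dot_plus; field.
Qed.

(** With [g] the holomorphic component [<v, f> + i <Jv, f>] of [f] on the slice
    of [J], the holomorphic function [g - stem f v - i stem f (Jv)] vanishes on
    the real axis, hence on [D], and its real part is
    [<v, f(x + yJ) - b - Jc>]. *)
Theorem representation_formula (J : quat) (z : R * R) :
  imaginary_unit J -> D z ->
  f (qpoint J (fst z) (snd z)) = plus (slice_even f z) (qmult J (slice_odd f z)).
Proof.
  intros HJ Dz.
  assert (HDJ : forall w, D w <-> slice Omega J w).
  { intros w; split; apply slice_symmetric; auto using unit_i_imaginary. }
  apply dot_ext; intros v.
  assert (Hf : holomorphic_on J D (fun w => f (qpoint J (fst w) (snd w)))).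
  { destruct (Hreg J HJ) as [Fx [Fy H]]; exists Fx, Fy; intros x y Dxy.
    now apply H, HDJ. }
  destruct (holomorphic_on_component J D _ v HJ (proj1 base_domain) Hf) as [F' HF].
  destruct (stem_holomorphic v) as [S' HS].
  destruct (stem_holomorphic (qmult J v)) as [T' HT].
  destruct base_meets_reals as [x0 Hx0].
  pose proof (holomorphic_plus D _ _ _ _ HF
    (holomorphic_plus D _ _ _ _
       (holomorphic_mult D _ _ _ _ (holomorphic_const D (- (1))%C) HS)
       (holomorphic_mult D _ _ _ _ (holomorphic_const D (- Ci)%C) HT))) as HE.
  pose proof (zero_of_zero_on_reals D _ _ x0 base_domain HE Hx0) as E.
  assert (E0 := E ltac:(intros x Dx; unfold stem; simpl;
    rewrite (qpoint_real _ _ HJ), slice_odd_real, slice_even_real, !dot_zero;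
    apply injective_projections; simpl; ring) z Dz).
  apply (f_equal Re) in E0; simpl in E0.
  rewrite dot_plus, (dot_qmult J v) by exact HJ; lra.
Qed.

(** The restriction to the plane of [unit_i] of the symmetrization of [f], the
    regular product of [f] with its regular conjugate; it equals
    [|b|^2 - |c|^2 + 2i <b, c>]. *)
Definition symmetrization (z : C) : C :=
  (stem f (1, 0, 0, 0) z * stem f (1, 0, 0, 0) z +
   (stem f (0, 1, 0, 0) z * stem f (0, 1, 0, 0) z +
    (stem f (0, 0, 1, 0) z * stem f (0, 0, 1, 0) z +
     stem f (0, 0, 0, 1) z * stem f (0, 0, 0, 1) z)))%C.

Lemma symmetrization_holomorphic : exists F', holomorphic D symmetrization F'.
Proof.
  destruct (stem_holomorphic (1, 0, 0, 0)) as [A' HA].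
  destruct (stem_holomorphic (0, 1, 0, 0)) as [B' HB].
  destruct (stem_holomorphic (0, 0, 1, 0)) as [C' HC].
  destruct (stem_holomorphic (0, 0, 0, 1)) as [E' HE].
  eexists.
  exact (holomorphic_plus D _ _ _ _ (holomorphic_mult D _ _ _ _ HA HA)
    (holomorphic_plus D _ _ _ _ (holomorphic_mult D _ _ _ _ HB HB)
      (holomorphic_plus D _ _ _ _ (holomorphic_mult D _ _ _ _ HC HC)
         (holomorphic_mult D _ _ _ _ HE HE)))).
Qed.

(** From [b = -Jc] one gets [|b| = |c|], and [<b, c> = - <Jc, c> = 0] as [J] is
    imaginary. *)
Lemma symmetrization_zero (J : quat) (z : R * R) :
  imaginary_unit J -> plus (slice_even f z) (qmult J (slice_odd f z)) = zero ->
  symmetrization z = 0%C.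
Proof.
  intros HJ E; apply imaginary_unit_coords in HJ.
  destruct HJ as (b & c & d & -> & Hn).
  unfold symmetrization, stem.
  destruct (slice_even f z) as [[[e0 e1] e2] e3].
  destruct (slice_odd f z) as [[[o0 o1] o2] o3].
  pose proof (f_equal q_re E) as E0; pose proof (f_equal q_i E) as E1;
    pose proof (f_equal q_j E) as E2; pose proof (f_equal q_k E) as E3; clear E.
  quat_unfold.
  assert (H0 : e0 = b * o1 + c * o2 + d * o3) by lra.
  assert (H1 : e1 = - b * o0 - c * o3 + d * o2) by lra.
  assert (H2 : e2 = b * o3 - c * o0 - d * o1) by lra.
  assert (H3 : e3 = - b * o2 + c * o1 - d * o0) by lra.
  clear E0 E1 E2 E3; subst; apply injective_projections; simpl; nsatz.
Qed.

(** On the real axis [c = 0], so the symmetrization reduces to [|f|^2]. *)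
Lemma symmetrization_real (x : R) :
  symmetrization (x, 0) = 0%C -> f (RtoQuat x) = zero.
Proof.
  unfold symmetrization, stem; rewrite slice_odd_real, slice_even_real.
  intros E; apply (f_equal Re) in E.
  destruct (f (RtoQuat x)) as [[[e0 e1] e2] e3]; quat_unfold.
  assert (e0 = 0) by nra; assert (e1 = 0) by nra;
    assert (e2 = 0) by nra; assert (e3 = 0) by nra.
  subst; reflexivity.
Qed.

Lemma zero_of_symmetrization_zero :
  (forall z, D z -> symmetrization z = 0%C) ->
  forall q, Omega q -> f q = zero.
Proof.
  intros Hs q Hq.
  destruct base_meets_reals as [x0 Hx0].
  assert (Hstem : forall v z, D z -> stem f v z = 0%C).
  { intros v; destruct (stem_holomorphic v) as [S' HS].
    apply (zero_of_zero_on_reals D (stem f v) S' x0 base_domain HS Hx0).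
    intros x Dx; unfold stem.
    rewrite slice_odd_real, slice_even_real, (symmetrization_real x (Hs _ Dx)), dot_zero.
    reflexivity. }
  destruct (polar_spec q) as [J [HJ E]].
  assert (Dq : D (polar q)).
  { apply (slice_symmetric Omega J); auto using unit_i_imaginary.
    unfold slice; now rewrite <- E. }
  rewrite E, (representation_formula J _ HJ Dq).
  apply dot_ext; intros v; rewrite dot_plus, (dot_qmult J) by exact HJ.
  pose proof (f_equal Re (Hstem v _ Dq)) as E1.
  pose proof (f_equal Im (Hstem (qmult J v) _ Dq)) as E2.
  simpl in E1, E2; rewrite E1, E2, dot_zero; ring.
Qed.

(** The zeros of the symmetrization are isolated, since it is not identically
    zero, and it vanishes at the polar coordinates of every zero of [f]. *)
Lemma zeros_near_one_sphere (z : R * R) :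
  ~ (forall q, Omega q -> f q = zero) -> D z ->
  exists r, 0 < r /\
    forall q, Cmod ((polar q : C) - z) < r -> Omega q -> f q = zero -> polar q = z.
Proof.
  intros Hf Dz.
  destruct symmetrization_holomorphic as [S' HS].
  destruct (identity_theorem D _ _ base_domain HS) as [H|H].
  { destruct Hf; now apply zero_of_symmetrization_zero. }
  destruct (H z Dz) as [r [Hr Hnz]].
  exists r; split; [exact Hr|]; intros q Hq Omq fq.
  apply NNPP; intros Hne; apply (Hnz (polar q) Hq Hne).
  destruct (polar_spec q) as [J [HJ E]].
  apply (symmetrization_zero J _ HJ).
  rewrite <- representation_formula; [now rewrite <- E|exact HJ|].
  apply (slice_symmetric Omega J); auto using unit_i_imaginary.
  unfold slice; now rewrite <- E.
Qed.

(** Subtracting [b + Jc = 0] and [b + Kc = 0] gives [(J - K) c = 0], so [c = 0]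
    and then [b = 0]. *)
Lemma sphere_zero_of_two_zeros (J K : quat) (z : R * R) :
  imaginary_unit J -> imaginary_unit K -> J <> K -> D z ->
  f (qpoint J (fst z) (snd z)) = zero -> f (qpoint K (fst z) (snd z)) = zero ->
  forall L, imaginary_unit L -> f (qpoint L (fst z) (snd z)) = zero.
Proof.
  intros HJ HK Hne Dz EJ EK L HL.
  rewrite representation_formula in EJ, EK |- * by assumption.
  assert (Ho : slice_odd f z = zero).
  { apply (qmult_cancel (minus J K)).
    - intros E; apply Hne, dot_ext; intros v.
      apply (f_equal (dot v)) in E; unfold minus in E.
      rewrite dot_plus, dot_opp, dot_zero in E; lra.
    - apply dot_ext; intros v; rewrite qmult_minus_l; unfold minus.
      apply (f_equal (dot v)) in EJ, EK.
      rewrite dot_plus, dot_opp; rewrite dot_plus, dot_zero in *; lra. }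
  assert (E0 : forall I, imaginary_unit I -> qmult I zero = zero).
  { intros I HI; apply dot_ext; intros v.
    rewrite (dot_qmult I) by exact HI; rewrite !dot_zero; ring. }
  rewrite Ho, E0 in EJ |- * by assumption; exact EJ.
Qed.

End Stem.

(** * The zero set *)

Theorem theorem1p12 :
  forall (Omega : quat -> Prop) (f : quat -> quat),
    slice_domain Omega ->
    symmetric Omega ->
    regular Omega f ->
    ~ (forall q : quat, Omega q -> f q = zero) ->
    exists family : (quat -> Prop) -> Prop,
      (forall A : quat -> Prop, family A ->
         (is_point A \/ is_two_sphere A) /\ isolated_in (zero_set Omega f) A) /\
      (forall q : quat,
         zero_set Omega f q <-> exists A : quat -> Prop, family A /\ A q).
Proof.
  intros Omega f Hslice Hsym Hreg Hf.
  (* The largest admissible family: it remains to put every zero in a member. *)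
  exists (fun A => (is_point A \/ is_two_sphere A) /\ isolated_in (zero_set Omega f) A).
  split; [now intros A HA|].
  intros q; split.
  2: { intros [A [[_ [HA _]] Aq]]; exact (HA q Aq). }
  intros [Omq fq].
  destruct (polar_spec q) as [J [HJ E]].
  assert (HD : forall p, polar p = polar q -> Omega p /\ slice Omega unit_i (polar q)).
  { intros p Ep; destruct (polar_spec p) as [K [HK EK]]; rewrite Ep in EK.
    assert (HJz : slice Omega J (polar q)) by (unfold slice; now rewrite <- E).
    split.
    - rewrite EK; exact (slice_symmetric Omega J K _ Hsym HJ HK HJz).
    - exact (slice_symmetric Omega J unit_i _ Hsym HJ unit_i_imaginary HJz). }
  destruct (HD q eq_refl) as [_ Dz].
  destruct (zeros_near_one_sphere Omega f Hslice Hsym Hreg _ Hf Dz) as [r [Hr Hnear]].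
  (* One neighbourhood serves both cases: the set of points whose sphere is close
     to that of [q], all zeros of which lie on the sphere of [q]. *)
  assert (Hiso : forall A : quat -> Prop, A q ->
    (forall p, A p -> zero_set Omega f p) -> (forall p, A p -> polar p = polar q) ->
    (forall p, polar p = polar q -> zero_set Omega f p -> A p) ->
    isolated_in (zero_set Omega f) A).
  { intros A Aq AZ Asph Aall; split; [exact AZ|].
    exists (fun p => Cmod ((polar p : C) - polar q) < r); split; [|split].
    - apply (open_comp polar (fun w : R * R => Cmod ((w : C) - polar q) < r)).
      + intros p _; apply polar_continuous.
      + apply Cdisc_open.
    - intros p Ap; rewrite (Asph p Ap).
      replace ((polar q : C) - polar q)%C with (RtoC 0) by ring.
      rewrite Cmod_0; exact Hr.
    - intros p Up [Omp fp]; apply Aall; [|now split].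
      now apply Hnear. }
  destruct (classic (snd (polar q) <> 0 /\
    forall p, polar p = polar q -> f p = zero)) as [[Hy Hall]|Hnot].
  - exists (fun p => polar p = polar q); split; [split|reflexivity].
    + right; exists (fst (polar q)), (snd (polar q)); split; [exact Hy|].
      intros p; split.
      * intros Ep; destruct (polar_spec p) as [K [HK EK]].
        exists K; split; [exact HK|]; now rewrite <- Ep.
      * intros [K [HK ->]]; rewrite polar_qpoint; [|exact HK|apply sqrt_pos].
        now rewrite <- surjective_pairing.
    + apply Hiso; auto.
      intros p Ep; split; [exact (proj1 (HD p Ep))|now apply Hall].
  - exists (fun p => p = q); split; [split|reflexivity].
    + left; now exists q.
    + apply Hiso; [reflexivity|intros p ->; now split|now intros p ->|].
      intros p Ep [_ fp].
      destruct (polar_spec p) as [K [HK EK]]; rewrite Ep in EK.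
      apply NNPP; intros Hne; apply Hnot; split.
      * intros Hy; apply Hne; rewrite Hy, qpoint_real in E, EK by assumption.
        exact (eq_trans EK (eq_sym E)).
      * assert (HJK : J <> K) by (intros <-; apply Hne; exact (eq_trans EK (eq_sym E))).
        rewrite E in fq; rewrite EK in fp.
        intros p' Ep'; destruct (polar_spec p') as [L [HL EL]]; rewrite Ep' in EL.
        rewrite EL.
        exact (sphere_zero_of_two_zeros Omega f Hslice Hsym Hreg J K _ HJ HK HJK Dz
                 fq fp L HL).
Qed.
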